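(* Let $\zeta_Z(t),t\ge0$ be a max-stable and stationary process associated to a spectral process $Z(t),t\ge0$ with $\mathbb E\{e^{Z(t)}\}=1$ for $t\ge0$. If $\mathbb P\{Z(h)>-\infty\}=1$ for any $h\ge0$, then there exists a random process $Y(t),t\in\mathbb R$ such that for any distinct $t_1,\ldots,t_n\in\mathbb R$ $$\bigl(Y(t_1),\ldots,Y(t_n)\bigr)\overset{d}{=}\bigl(\Xi_hZ(t_1+h),\ldots,\Xi_hZ(t_n+h)\bigr),\qquad h:=-\min\bigl(0,\min_{1\le j\le n}t_j\bigr),$$ and $\zeta_Y(t)\overset{fdd}{=}\zeta_Z(t)$, $t\ge0$. Moreover, $Y(t),t\in\mathbb R$ is Brown-Resnick stationary.
   Context: $\overset{fdd}{=}$ means equality of all finite dimensional distributions. Processes take values in $[-\infty,\infty)$, $e^{-\infty}=0$. For an index set $\mathcal T$ (here $[0,\infty)$ or $\mathbb R$) and a process $Z(t),t\in\mathcal T$, the associated max-stable process is $\zeta_Z(t)=\max_{i\ge1}(P_i+Z_i(t))$, $t\in\mathcal T$, where $\sum_i\varepsilon_{P_i}$ is a Poisson point process on $\mathbb R$ with intensity $e^{-x}dx$ and $Z_i$ are independent copies of $Z$, independent of the point process; $\zeta_Y$ is defined likewise from $Y$ with $\mathcal T=\mathbb R$. Stationarity of $\zeta_Z(t),t\ge0$ means that $\zeta_Z(\cdot+h)\overset{fdd}{=}\zeta_Z(\cdot)$ on $[0,\infty)$ for all $h\ge0$. $Y$ is called Brown-Resnick stationary if $\zeta_Y(t),t\in\mathbb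 R$ is stationary. The tilt $Z^{[h]}$ of $Z$ by $Z(h)$ has law $\mathbb P\{Z^{[h]}\in A\}=\mathbb E\{e^{Z(h)}\mathbb I\{Z\in A\}\}$ for $A$ in the $\sigma$-field generated by evaluation maps, and $\Xi_hZ(t)=Z^{[h]}(t)-Z^{[h]}(h)$, $t\ge0$. *)

(* Defs.v *)
From HB Require Import structures.
From mathcomp Require Import all_boot all_order all_algebra finmap.
From mathcomp Require Import all_classical all_reals all_analysis.
From mathcomp Require Import measurable_realfun.

Set Implicit Arguments.
Unset Strict Implicit.
Unset Printing Implicit Defensive.

Import Order.TTheory GRing.Theory Num.Theory.
Import numFieldNormedType.Exports.

Local Open Scope classical_set_scope.
Local Open Scope ring_scope.
Local Open Scope ereal_scope.

(* A process with index set I (a subset of R) is a family of functions indexed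
   by the whole of R; its values at indices outside I carry no information and
   no definition below depends on them. *)

Definition nonneg_times (R : realType) : set R := [set t | (0 <= t)%R].
Arguments nonneg_times : clear implicits.

Definition process d (W : measurableType d) (R : realType) (I : set R)
    (X : R -> W -> \bar R) : Prop :=
  (forall t, I t -> measurable_fun setT (X t)) /\
  (forall t w, I t -> X t w < +oo).

(* Laws are set functions on the path space R -> \bar R, meant to be evaluated
   on sets of the sigma-algebra generated by the evaluations at times of I. *)

Definition law d (W : measurableType d) (R : realType) (P : probability W R)
    (X : R -> W -> \bar R) (A : set (R -> \bar R)) : \bar R :=
  P [set w | A (X ^~ w)].

Definition marginal (R : realType) (mu : set (R -> \bar R) -> \bar R)
    (n : nat) (t : n.-tuple R) (B : set (n.-tuple (\bar R))) : \bar R :=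
  mu [set f | B (map_tuple f t)].

Definition fdd_eq (R : realType) (I : set R)
    (mu nu : set (R -> \bar R) -> \bar R) : Prop :=
  forall (n : nat) (t : n.-tuple R) (B : set (n.-tuple (\bar R))),
    (forall s, s \in t -> I s) -> measurable B ->
    marginal mu t B = marginal nu t B.

Definition stationary d (W : measurableType d) (R : realType) (I : set R)
    (P : probability W R) (X : R -> W -> \bar R) : Prop :=
  forall h : R, I h -> fdd_eq I (law P (fun t => X (t + h)%R)) (law P X).

Definition mutually_independent d (W : measurableType d) (R : realType)
    (P : probability W R) (K : choiceType) (F : K -> set (set W)) : Prop :=
  forall (J : {fset K}) (E : K -> set W), (forall k, k \in J -> F k (E k)) ->
    P (\bigcap_(k in [set` J]) E k) = \prod_(k <- J) P (E k).

Definition sigma_family d (W : measurableType d) d' (V : measurableType d')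
    (K : Type) (D : set K) (X : K -> W -> V) : set (set W) :=
  <<s \bigcup_(k in D) g_sigma_algebra_preimage (X k) >>.

Definition gumbel_intensity (R : realType) (B : set R) : \bar R :=
  \int[lebesgue_measure]_(x in B) (expR (- x))%:E.

Definition point_count (W : Type) (R : realType) (pts : nat -> W -> R)
    (B : set R) (w : W) : \bar R :=
  \sum_(i <oo) (\1_B (pts i w) : R)%:E.

(* The rate gumbel_intensity B may be 0, where poisson_pmf is not the mass
   function of the Poisson law but poisson_prob is the Dirac mass at 0; the
   second argument of poisson_prob is unused. *)
Definition gumbel_poisson_process d (W : measurableType d) (R : realType)
    (Q : probability W R) (pts : nat -> W -> R) : Prop :=
  [/\ forall i, measurable_fun setT (pts i),
      forall B : set R, measurable B -> gumbel_intensity B < +oo ->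
        forall k : nat, Q [set w | point_count pts B w = k%:R%:E] =
          poisson_prob (fine (gumbel_intensity B)) 0 [set k],
      forall B : set R, measurable B -> gumbel_intensity B = +oo ->
        Q [set w | point_count pts B w = +oo] = 1 &
      forall (n : nat) (B : 'I_n -> set R), (forall j, measurable (B j)) ->
        trivIset setT B ->
        mutually_independent Q
          (fun j => g_sigma_algebra_preimage (point_count pts (B j)))].

(* zeta, on the probability space of Q, is a max-stable process associated to
   the process Z with index set I: zeta(t) = max_i (P_i + Z_i(t)). The sequence
   of points (None) and the copies (Some i) are mutually independent; it would
   not be enough to have the copies independent of the unlabelled point set.
   The maximum is a supremum in \bar R, attained almost surely at each t when
   E e^(Z(t)) = 1. *)
Definition max_stable_process d (W : measurableType d) d' (V : measurableType d')
    (R : realType) (I : set R) (P : probability W R) (Z : R -> W -> \bar R)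
    (Q : probability V R) (zeta : R -> V -> \bar R) : Prop :=
  exists (pts : nat -> V -> R) (Zc : nat -> R -> V -> \bar R),
    [/\ gumbel_poisson_process Q pts,
        forall i, process I (Zc i) /\ fdd_eq I (law Q (Zc i)) (law P Z),
        mutually_independent Q (fun o : option nat =>
          if o is Some i then sigma_family I (Zc i)
          else sigma_family setT pts) &
        forall t v, I t ->
          zeta t v = ereal_sup (range (fun i => (pts i v)%:E + Zc i t v))].

(* All the max-stable processes associated to Y have the same finite
   dimensional distributions, hence the universal quantification. *)
Definition brown_resnick_stationary d (W : measurableType d) (R : realType)
    (P : probability W R) (Y : R -> W -> \bar R) : Prop :=
  forall d' (V : measurableType d') (Q : probability V R)
    (zeta : R -> V -> \bar R),
    max_stable_process setT P Y Q zeta -> stationary setT Q zeta.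

(* The law of Z^[h]. *)
Definition tilt_law d (W : measurableType d) (R : realType)
    (P : probability W R) (Z : R -> W -> \bar R) (h : R)
    (A : set (R -> \bar R)) : \bar R :=
  \int[P]_w (expeR (Z h w) * (\1_A (Z ^~ w) : R)%:E).

(* The law of Xi_h Z, the image of that of Z^[h] by f |-> f - f(h). Under the
   latter f(h) is almost surely finite. *)
Definition Xi_law d (W : measurableType d) (R : realType)
    (P : probability W R) (Z : R -> W -> \bar R) (h : R)
    (A : set (R -> \bar R)) : \bar R :=
  tilt_law P Z h [set f | A (fun t => f t - f h)].

(* Main.v *)
Require Import Defs.
From HB Require Import structures.
From mathcomp Require Import all_boot all_order all_algebra finmap.
From mathcomp Require Import all_classical all_reals all_analysis.
From mathcomp Require Import measurable_realfun.
From mathcomp Require Import ring lra.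

(** Write L_Z(t, c) for E max_j c_j e^(Z(t_j)), where c_j >= 0. The points p_i
    of the Poisson process and the copies Z_i form a marked Poisson process, and
    zeta_Z satisfies c_j e^(zeta_Z(t_j)) <= 1 for all j exactly when no i has
    max_j c_j e^(Z_i(t_j)) > e^(-p_i); this void event has probability
    exp(- L_Z(t, c)) (poisson_void_probability, max_stable_box_prob). The boxes
    of this form are stable under intersection and generate, so the finite
    dimensional distributions of zeta_Z and the exponents L_Z determine each
    other (tuple_law_unique, max_stable_marginal_eq); stationarity of zeta_Z
    means that L_Z(t + h, c) = L_Z(t, c).

    The exponents also know the tilted increments. The right derivative at
    c_0 = 1 of E max(c_0 e^(Z(h)), max_j c_j e^(Z(t_j))) is
    E(e^(Z(h)); max_j c_j e^(Z(t_j)) <= e^(Z(h))), a box probability of the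
    vector of increments Z(t_j) - Z(h) under the tilt by Z(h)
    (tilt_determined). By the shift invariance of L_Z, the law of
    (Z(t_j + h) - Z(h))_j under the tilt by Z(h) is therefore the same for all
    h >= 0 for which the times t_j + h are nonnegative (Xi_tilt). So the paths
    t |-> Z(t + n) - Z(n) on [-n, +oo[, under the tilts by Z(n), have laws which
    agree more and more as n grows, and a compactness argument
    (kolmogorov_extension) gives a law on all paths over the real line, that
    of Y.

    Because Z(h) > -oo almost surely, multiplying the increments from time h by
    e^(Z(h)) undoes the tilt and loses no mass: L_Y(t, c) = L_Z(t + h, c)
    whenever t + h >= 0 (two_sided_exponent). The right side is L_Z(t, c) when
    t >= 0, and it is invariant under shifts of t. Through the void
    probabilities this says that zeta_Y and zeta_Z have the same finite
    dimensional distributions on [0, +oo[ and that zeta_Y is stationary. A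
    process zeta_Y exists on the product of the space which carries the Poisson
    points of zeta_Z and a space of independent copies of Y
    (max_stable_exists). *)

Set Implicit Arguments.
Unset Strict Implicit.
Unset Printing Implicit Defensive.

Import Order.TTheory GRing.Theory Num.Theory.
Import numFieldNormedType.Exports.

Local Open Scope classical_set_scope.
Local Open Scope ring_scope.
Local Open Scope ereal_scope.

(** * Path spaces and cylinder sets *)
Section image_law.
Context d d' (T : measurableType d) (T' : measurableType d') (R : realType).
Variables (P : probability T R) (f : T -> T') (mf : measurable_fun setT f).

Definition image_law : probability T' R :=
  distribution P (mfun_Sub (mem_set mf)).

End image_law.

Section path_space.
Context (K : choiceType) d (T : measurableType d).

Definition evaluation_sets : set (set (K -> T)) :=
  \bigcup_k preimage_set_system setT (fun f : K -> T => f k) measurable.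

Definition paths := g_sigma_algebraType evaluation_sets.

Lemma measurable_evaluation k : measurable_fun setT (fun f : paths => f k).
Proof.
move=> _ A mA; apply: sub_sigma_algebra.
by exists k => //; exists A.
Qed.

Lemma measurable_to_paths d' (V : measurableType d') (F : V -> paths) :
  (forall k, measurable_fun setT (fun v => F v k)) -> measurable_fun setT F.
Proof.
move=> mF; apply: (@measurability _ _ _ paths setT F evaluation_sets) => //.
move=> _ [B [k _ [A mA <-]] <-].
by rewrite !setTI; have := mF k measurableT _ mA; rewrite setTI.
Qed.

End path_space.

(** Cylinders are described by the coordinates which they may depend on rather
    than as preimages of measurable sets of finite tuples. The complement and
    the union of cylinders over different sets of coordinates are then cylinders
    with no change of index type. *)
Definition depends_on (K : choiceType) (T : Type) (J : seq K)
    (A : set (K -> T)) :=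
  forall f g : K -> T, {in J, f =1 g} -> A f -> A g.

Section depends_on.
Context (K : choiceType) (T : Type).
Implicit Types (A B : set (K -> T)) (J : seq K).

Lemma depends_onC J A : depends_on J A -> depends_on J (~` A).
Proof. by move=> dA f g fg nAf Ag; apply/nAf/(dA g) => // k /fg. Qed.

Lemma depends_on_sub J J' A : {subset J <= J'} -> depends_on J A ->
  depends_on J' A.
Proof. by move=> JJ' dA f g fg; apply: dA => k /JJ'; exact: fg. Qed.

Lemma depends_onU J A B : depends_on J A -> depends_on J B ->
  depends_on J (A `|` B).
Proof.
by move=> dA dB f g fg [|] ?; [left; exact: (dA f)|right; exact: (dB f)].
Qed.

Lemma depends_on0 A : depends_on [::] A -> A = set0 \/ A = setT.
Proof.
move=> dA; have [->|/set0P[f Af]] := eqVneq A set0; first by left.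
by right; apply/seteqP; split => // g _; exact: (dA f).
Qed.

End depends_on.

(** Induction on the coordinates: A is the union, over the two values b at j, of
    the paths with value b at j whose modification by b lies in A, and to belong
    to this modified set depends on the remaining coordinates only. *)
Lemma measurable_depends_on_bool (K : choiceType) (J : seq K)
  (A : set (paths K bool)) : depends_on J A -> measurable A.
Proof.
elim: J A => [A /depends_on0[]->//|j J ih A dA].
pose upd b (f : K -> bool) k := if k == j then b else f k.
pose Ab b : set (paths K bool) := [set f | A (upd b f)].
have mAb b : measurable (Ab b).
  apply: ih => f g fg; apply: dA => k; rewrite inE /upd.
  by case: eqP => //= _; exact: fg.
have -> : A = \bigcup_(b in [set: bool]) (Ab b `&` (fun f : paths K bool => f j) @^-1` [set b]).
  apply/seteqP; split => [f Af|f [b _ [+ /= fj]]].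
    exists (f j) => //; split => //; rewrite /Ab/=.
    by apply: dA Af => k _; rewrite /upd; case: eqP => // ->.
  by rewrite /Ab/=; apply: dA => k _; rewrite /upd; case: eqP => // ->.
apply: fin_bigcup_measurable => // b _; apply: measurableI => //.
by rewrite -[X in measurable X]setTI; exact: measurable_evaluation.
Qed.

Section cylinder_algebra.
Context (K : choiceType).

(** The cylinders of bits are closed under finite set operations and not under
    countable unions, so the algebra of cylinders needs a carrier of its own,
    distinct from the path space with its sigma-algebra. *)
Definition cylinder_space := prod_topology (fun _ : K => bool).

Definition cylinder : set (set cylinder_space) :=
  [set A | exists J : seq K, depends_on J A].

HB.instance Definition _ := Pointed.on cylinder_space.
HB.instance Definition _ := Nbhs.on cylinder_space.
HB.instance Definition _ := Topological.on cylinder_space.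

Let cylinder0 : cylinder set0.
Proof. by exists [::]. Qed.

Let cylinderU : setU_closed cylinder.
Proof.
move=> A B [J dA] [J' dB]; exists (J ++ J'); apply: depends_onU.
  by apply: depends_on_sub dA => k; rewrite mem_cat => ->.
by apply: depends_on_sub dB => k; rewrite mem_cat orbC => ->.
Qed.

Let cylinderC : setC_closed cylinder.
Proof. by move=> A [J dA]; exists J; exact: depends_onC. Qed.

HB.instance Definition _ := isAlgebraOfSets.Build (cylinder.-sigma)%mdisp
  cylinder_space cylinder0 cylinderU cylinderC.

End cylinder_algebra.

Section cylinder_compactness.
Context (K : choiceType).
Local Notation bool_product := (cylinder_space K).

Let nbhs_agree (f : bool_product) (J : seq K) :
  nbhs f [set g : bool_product | {in J, f =1 g}].
Proof.
elim: J => [|j J ih]; first by apply: filterS filterT => g _ k.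
have fj : nbhs f [set g : bool_product | f j = g j].
  have := @proj_continuous K (fun=> bool) j f.
  move=> /(_ [set b | f j = b]); apply.
  by rewrite /nbhs/= /principal_filter/=; apply/principal_filterP.
apply: filterS2 fj ih => g /= fgj fg k; rewrite inE => /predU1P[->//|].
exact: fg.
Qed.

Let open_cylinder (A : set bool_product) : cylinder A -> open A.
Proof.
move=> [J dA]; rewrite openE => f Af.
by apply: filterS (nbhs_agree f J) => g fg; exact: dA Af.
Qed.

(** Cylinders of bits are open and closed in the product topology, which is
    compact. A cylinder covered by countably many cylinders is thus covered by
    finitely many of them, which is why every finitely additive function on
    cylinders of bits is already a premeasure. *)
Lemma cylinder_finite_cover (A : set (cylinder_space K)) (F : (set (cylinder_space K))^nat) :
  cylinder A -> (forall i, cylinder (F i)) -> A `<=` \bigcup_i F i ->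
  exists n, A `<=` \big[setU/set0]_(i < n) F i.
Proof.
move=> cA cF AF.
have cptT : compact [set: bool_product].
  have := @tychonoff K (fun=> bool) (fun=> setT) (fun=> bool_compact).
  by congr (compact _); rewrite eqEsubset.
have clA : closed (A : set bool_product).
  rewrite -[A]setCK; apply/open_closedC/open_cylinder.
  by case: cA => J dA; exists J; exact: depends_onC.
have : compact (A : set bool_product) by apply: subclosed_compact clA cptT _.
rewrite compact_cover => /(_ nat setT F).
case=> [i _|//|D _ AD]; first exact: open_cylinder.
exists (\max_(i <- D) i).+1 => f /AD[i iD Fif].
rewrite -bigcup_mkord; exists i => //=.
by rewrite ltnS; apply: leq_bigmax_seq.
Qed.

End cylinder_compactness.

(** * Extension of stable families of laws *)
Section kolmogorov_bool.
Context (K : choiceType) (R : realType).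
Variable mu : nat -> probability (paths K bool) R.
Hypothesis mu_stable : forall J : seq K, exists N, forall n A,
  (N <= n)%N -> depends_on J A -> mu n A = mu N A.

(** On each cylinder the sequence is eventually constant. *)
Definition cylinder_limit (A : set (cylinder_space K)) : \bar R :=
  limn (fun n => mu n A).

Let cylinder_limitE (J : seq K) : exists N, forall n A,
  (N <= n)%N -> depends_on J A -> cylinder_limit A = mu n A.
Proof.
have [N muN] := mu_stable J; exists N => n A Nn dA; rewrite (muN n)//.
apply: lim_near_cst => //.
by near=> m; apply: muN => //; near: m; exact: nbhs_infty_ge.
Unshelve. all: by end_near. Qed.

Let cylinder_limit_ge0 A : 0 <= cylinder_limit A.
Proof.
have [cvg|ncvg] := pselect (cvgn (fun n => mu n A)).
  by apply: lime_ge => //; apply: nearW => n.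
by rewrite /cylinder_limit dvgP.
Qed.

Let cylinder_limit_additive : measure_function.semi_additive cylinder_limit.
Proof.
move=> F n cF tF _; have {cF}[J dF] := choice cF.
pose Jn := flatten [seq J i | i <- iota 0 n].
have dFn i : (i < n)%N -> depends_on Jn (F i).
  move=> i_n; apply: depends_on_sub (dF i) => k kJ.
  by apply/flatten_mapP; exists i; rewrite ?mem_iota.
have dU : depends_on Jn (\big[setU/set0]_(i < n) F i).
  rewrite big_seq; elim/big_ind: _ => // [A B|i _]; first exact: depends_onU.
  exact: dFn.
have [N muN] := cylinder_limitE Jn.
rewrite (muN N)// measure_bigsetU.
- by apply: eq_bigr => i _; rewrite (muN N)//; exact: dFn.
- by move=> i; apply: measurable_depends_on_bool (dF i).
- exact: tF.
Qed.

HB.instance Definition _ := isContent.Build _ (cylinder_space K) R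
  cylinder_limit cylinder_limit_ge0 cylinder_limit_additive.

Let cylinder_limit_sigma_subadditive :
  measurable_subset_sigma_subadditive cylinder_limit.
Proof.
move=> A F cF cA AF; have [n AFn] := cylinder_finite_cover cA cF AF.
apply: (@le_trans _ _ (\sum_(i < n) cylinder_limit (F i))).
  exact: content_subadditive.
rewrite -(big_mkord xpredT (cylinder_limit \o F)).
by apply: nneseries_lim_ge => i _ _; exact: cylinder_limit_ge0.
Qed.

HB.instance Definition _ := Content_SigmaSubAdditive_isMeasure.Build _ R
  (cylinder_space K) cylinder_limit cylinder_limit_sigma_subadditive.

(** The eventual values form a content on the algebra of cylinders, which is
    countably subadditive by compactness, and Caratheodory's extension gives the
    measure. *)
Lemma kolmogorov_bool : exists nu : probability (paths K bool) R,
  forall J : seq K, exists N, forall n A,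
    (N <= n)%N -> depends_on J A -> nu A = mu n A.
Proof.
pose I : measurableType _ := g_sigma_algebraType (@measurable _ (cylinder_space K)).
pose ext : {measure set I -> \bar R} := measure_extension cylinder_limit.
have mid : measurable_fun [set: I] (id : I -> paths K bool).
  apply: measurable_to_paths => k _ B mB; rewrite setTI.
  apply: sub_sigma_algebra; exists [:: k] => f g fg /=.
  by rewrite fg// inE.
have extE (A : set I) : cylinder A -> ext A = cylinder_limit A.
  by move=> cA; exact: measurable_mu_extE.
have ext1 : ext setT = 1.
  rewrite extE; last by exists [::].
  by have [N muN] := cylinder_limitE [::]; rewrite (muN N)// probability_setT.
pose extP : probability I R := HB.pack (Measure.sort ext)
  (Measure_isProbability.Build _ I R ext ext1).
pose nu := image_law extP mid.
exists nu => J; have [N muN] := cylinder_limitE J; exists N => n A Nn dA.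
by rewrite -(muN n)// -extE//; exists J.
Qed.

End kolmogorov_bool.

Lemma probability_unique d (T : measurableType d) (R : realType)
    (G : set (set T)) (m1 m2 : probability T R) :
  G `<=` measurable -> setI_closed G -> G setT ->
  (forall A, G A -> m1 A = m2 A) -> forall A, <<s G >> A -> m1 A = m2 A.
Proof.
move=> mG GI GT m12; apply: (g_sigma_algebra_measure_unique G mG (fun=> setT)) => //.
- by apply/seteqP; split => // x _; exists 0%N.
- by move=> _; rewrite (le_lt_trans (probability_le1 _ _)) ?ltry.
Qed.

Lemma cylinder_generates (K : choiceType) (A : set (paths K bool)) :
  measurable A -> <<s cylinder (K := K) >> A.
Proof.
move: A; apply: smallest_sub; first exact: smallest_sigma_algebra.
move=> _ [k _ [B _ <-]]; apply: sub_sigma_algebra.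
by exists [:: k] => f g fg [_ Bf]; split => //=; rewrite -fg// inE.
Qed.

Lemma cylinderI (K : choiceType) : setI_closed (@cylinder K).
Proof. by move=> A B cA cB; exact: (@measurableI _ (cylinder_space K)). Qed.

Lemma rat_between (R : realType) (x y : \bar R) : x < y ->
  exists q : rat, x < (ratr q)%:E < y.
Proof.
have btw (a b : R) : (a < b)%R -> exists q : rat, (a%:E < (ratr q)%:E < b%:E).
  by move=> /rat_in_itvoo[q]; rewrite in_itv/= => qab; exists q; rewrite !lte_fin.
case: x y => [a| |] [b| |]//=.
- by rewrite lte_fin; exact: btw.
- have [|q /andP[aq _] _] := @btw a (a + 1)%R; first by rewrite ltrDl.
  by exists q; rewrite aq ltry.
- have [|q /andP[_ qb] _] := @btw (b - 1)%R b; first by rewrite gtrBl.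
  by exists q; rewrite qb ltNyr.
- by exists 0%R; rewrite ltNyr ltry.
Qed.

(** A path with extended real values is coded by bits: the bit at (k, q) tells
    whether the value at k lies below the rational q. The value is recovered as
    the infimum of the rationals above it. The coding is not onto, and uncut is
    its left inverse only. *)
Section rational_cuts.
Context (K : choiceType) (R : realType).

Definition cuts (f : paths K (\bar R)) : paths (K * rat)%type bool :=
  fun kq => f kq.1 < (ratr kq.2)%:E.

Definition uncut (w : paths (K * rat)%type bool) : paths K (\bar R) :=
  fun k => ereal_inf [set (ratr q)%:E | q in [set q : rat | w (k, q)]].

Lemma cutsK : cancel cuts uncut.
Proof.
move=> f; apply/funext => k; apply/eqP; rewrite eq_le; apply/andP; split.
  rewrite leNgt; apply/negP => /rat_between[q /andP[fq qinf]].
  move: qinf; rewrite ltNge => /negP; apply; apply: ge_ereal_inf.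
  by exists (ratr q)%:E => //; exists q.
by apply: le_ereal_inf_tmp => _ [q /= fq <-]; exact: ltW.
Qed.

Lemma measurable_cuts : measurable_fun setT cuts.
Proof.
apply: measurable_to_paths => kq; apply: (measurable_fun_bool true).
rewrite setTI (_ : _ @^-1` _ = (fun f : paths K (\bar R) => f kq.1) @^-1` `]-oo, (ratr kq.2)%:E[).
  by rewrite -[X in measurable X]setTI; apply: measurable_evaluation => //; exact: emeasurable_itv.
by apply/seteqP; split=> f; rewrite /= in_itv.
Qed.

Lemma measurable_uncut : measurable_fun setT uncut.
Proof.
apply: measurable_to_paths => k.
apply: (measurability _ (ErealGenInftyO.measurableE R)) => _ /= -[_ [r ->] <-].
rewrite setTI (_ : _ @^-1` _ = \bigcup_(q in [set q : rat | (ratr q < r)%R])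
    ((fun w : paths (K * rat)%type bool => w (k, q)) @^-1` [set true])); last first.
  apply/seteqP; split=> [w /=|w [q /= qr wq]]; rewrite in_itv/=.
    move=> /ereal_inf_lt[_ [q wq <-]]; rewrite lte_fin => qr.
    by exists q.
  apply: (@le_lt_trans _ _ (ratr q)%:E); last by rewrite lte_fin.
  by apply: ge_ereal_inf; exists (ratr q)%:E => //; exists q.
rewrite bigcup_mkcond; apply: bigcupT_measurable_rat => q; case: ifP => // _.
by rewrite -[X in measurable X]setTI; exact: measurable_evaluation.
Qed.

End rational_cuts.

Section kolmogorov.
Context (K : choiceType) (R : realType).
Variable mu : nat -> probability (paths K (\bar R)) R.
Hypothesis mu_stable : forall J : seq K, exists N, forall n (A : set (paths K (\bar R))),
  (N <= n)%N -> measurable A -> depends_on J A -> mu n A = mu N A.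

Let mu_bool n := image_law (mu n) (@measurable_cuts K R).

Let cuts_depends J (A : set (K * rat -> bool)) :
  depends_on J A -> depends_on (map fst J) (@cuts K R @^-1` A).
Proof.
move=> dA f g fg; apply: dA => kq kqJ; rewrite /cuts fg//.
exact: map_f.
Qed.

Let measurable_cuts_preimage (A : set (paths (K * rat)%type bool)) :
  measurable A -> measurable (@cuts K R @^-1` A).
Proof.
by move=> mA; rewrite -[X in measurable X]setTI; exact: measurable_cuts.
Qed.

(** The extension theorem for laws of [-oo, +oo]-valued paths, in the form which
    suits a sequence of laws whose marginals are eventually constant. The laws
    are moved to paths of bits by cuts, extended there, and moved back. One
    coordinate k of the original path becomes the infinitely many bits (k, q),
    so an event depending on the coordinates in J need not be a cylinder of bits; the
    map r, which erases the bits outside J, reduces the comparison to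
    cylinders. *)
Theorem kolmogorov_extension : exists nu : probability (paths K (\bar R)) R,
  forall J : seq K, exists N, forall n (A : set (paths K (\bar R))),
    (N <= n)%N -> measurable A -> depends_on J A -> nu A = mu n A.
Proof.
have [|nu' nu'E] := @kolmogorov_bool _ _ mu_bool.
  move=> J; have [N muN] := mu_stable (map fst J); exists N => n A Nn dA.
  apply: muN => //; last exact: cuts_depends.
  exact: measurable_cuts_preimage (measurable_depends_on_bool dA).
exists (image_law nu' (@measurable_uncut K R)) => J.
have [N muN] := mu_stable J; exists N => n A Nn mA dA.
pose r (w : paths (K * rat)%type bool) : paths (K * rat)%type bool :=
  fun kq => (kq.1 \in J) && w kq.
have mr : measurable_fun setT r.
  apply: measurable_to_paths => kq; rewrite /r.
  case: (kq.1 \in J) => /=; last exact: measurable_cst.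
  exact: measurable_evaluation.
(* Not every event on the bits with indices in J depends on finitely many of
   them, so the agreement is extended from cylinders to all such events. *)
have rE (B : set (paths (K * rat)%type bool)) : measurable B ->
    nu' (r @^-1` B) = mu_bool n (r @^-1` B).
  move=> /cylinder_generates; apply: (probability_unique
    (m1 := image_law nu' mr) (m2 := image_law (mu_bool n) mr)).
  - by move=> C [J' dC]; exact: measurable_depends_on_bool dC.
  - exact: cylinderI.
  - by exists [::].
  - move=> C [J' dC].
    pose J'' := [seq kq <- J' | kq.1 \in J].
    have drC : depends_on J'' (r @^-1` C).
      move=> f g fg; apply: dC => kq kqJ'; rewrite /r.
      case: (boolP (kq.1 \in J)) => //= kqJ; apply: fg.
      by rewrite mem_filter kqJ.
    have [N' nu'N] := nu'E J''.
    change (nu' (r @^-1` C) = mu_bool n (r @^-1` C)).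
    rewrite (nu'N (maxn N N') _ (leq_maxr _ _) drC).
    change (mu (maxn N N') (@cuts K R @^-1` (r @^-1` C)) =
            mu n (@cuts K R @^-1` (r @^-1` C))).
    have dcrC : depends_on J (@cuts K R @^-1` (r @^-1` C)).
      apply: depends_on_sub (cuts_depends drC) => k /mapP[kq + ->].
      by rewrite mem_filter => /andP[].
    have mcrC := measurable_cuts_preimage (measurable_depends_on_bool drC).
    by rewrite (muN _ _ (leq_maxl _ _) mcrC dcrC) (muN _ _ Nn mcrC dcrC).
have uncut_r : @uncut K R @^-1` A = r @^-1` (@uncut K R @^-1` A).
  have uncutJ w : {in J, @uncut K R w =1 @uncut K R (r w)}.
    move=> k kJ; rewrite /uncut /r; congr ereal_inf.
    by apply/seteqP; split => _ [q /= wq <-]; exists q => //=; move: wq; rewrite /= kJ.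
  apply/seteqP; split => w /=; apply: dA => k kJ; [|apply/esym]; exact: uncutJ.
change (nu' (@uncut K R @^-1` A) = mu n A).
rewrite uncut_r rE; last first.
  by rewrite -[X in measurable X]setTI; exact: measurable_uncut.
rewrite -uncut_r; change (mu n (@cuts K R @^-1` (@uncut K R @^-1` A)) = mu n A).
congr (mu n _).
by apply/seteqP; split => f /=; rewrite cutsK.
Qed.

End kolmogorov.

(** * Boxes that determine laws of vectors *)
Lemma measurable_expeR (R : realType) : measurable_fun setT (@expeR R).
Proof.
apply: (measurability _ (ErealGenOInfty.measurableE R)) => _ [_ [r ->] <-].
rewrite setTI; have [r0|r0] := leP 0%R r.
  have [y yr] : exists y, expeR y = r%:E by apply: expeR_total; rewrite lee_fin.
  rewrite (_ : _ @^-1` _ = `]y, +oo[%classic); first exact: emeasurable_itv.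
  by apply/seteqP; split => x; rewrite /= !in_itv/= !andbT -yr lte_expeR.
rewrite (_ : _ @^-1` _ = setT)//; apply/seteqP; split => // x _.
by rewrite /= in_itv/= andbT (lt_le_trans _ (expeR_ge0 x)).
Qed.

Section exponential_boxes.
Context (R : realType) (n : nat).

(** The box of the x with x_i <= - ln c_i, written so that c_i = 0 stands for
    the bound +oo. *)
Definition exp_box (c : 'I_n -> R) : set (n.-tuple (\bar R)) :=
  [set x | forall i, (c i)%:E * expeR (tnth x i) <= 1].

Lemma measurable_scaled_expeR (r : R) :
  measurable_fun setT (fun x : \bar R => r%:E * expeR x).
Proof. by apply: measurable_funeM; exact: measurable_expeR. Qed.

Lemma measurable_exp_box c : measurable (exp_box c).
Proof.
rewrite (_ : exp_box c = \bigcap_(i in [set: 'I_n])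
    ((fun x : n.-tuple (\bar R) => (c i)%:E * expeR (tnth x i)) @^-1`
      [set y | y <= 1])); last first.
  by apply/seteqP; split => x bx i => [_|]; exact: bx.
apply: fin_bigcap_measurable => // i _.
rewrite -[X in measurable X]setTI.
apply: emeasurable_fun_infty_c => //.
apply: (@measurableT_comp _ _ _ _ _ _ (fun x : \bar R => (c i)%:E * expeR x)).
  exact: measurable_scaled_expeR.
exact: measurable_tnth.
Qed.

Lemma exp_boxI c c' : (forall i, 0 <= c i)%R -> (forall i, 0 <= c' i)%R ->
  exp_box c `&` exp_box c' = exp_box (fun i => Num.max (c i) (c' i)).
Proof.
move=> c0 c'0; apply/seteqP; split => [x [cx c'x] i|x cx].
  by case: (leP (c i) (c' i)) => _; [exact: c'x|exact: cx].
split=> i; apply: le_trans (cx i); rewrite lee_wpmul2r ?expeR_ge0//.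
  by rewrite lee_fin le_max lexx.
by rewrite lee_fin le_max lexx orbT.
Qed.

Definition exp_boxes : set (set (n.-tuple (\bar R))) :=
  [set exp_box c | c in [set c | forall i, (0 <= c i)%R]].

(** The ray x_i <= r is the box whose only nonzero weight is c_i = e^(-r). *)
Lemma exp_boxes_generate (B : set (n.-tuple (\bar R))) :
  measurable B -> <<s exp_boxes >> B.
Proof.
pose T := g_sigma_algebraType exp_boxes.
have mtnth (i : 'I_n) : measurable_fun setT ((fun x => tnth x i) : T -> \bar R).
  apply: (measurability _ (ErealGenOInfty.measurableE R)) => _ [_ [r ->] <-].
  rewrite setTI -setCitvl preimage_setC; apply: measurableC.
  apply: sub_sigma_algebra.
  exists (fun j => if j == i then expR (- r) else 0)%R.
    by move=> j /=; case: ifP => // _; exact: expR_ge0.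
  apply/seteqP; split => x; rewrite /= in_itv/=.
    move=> /(_ i); rewrite eqxx -[(expR _)%:E]/(expeR (- r%:E)) -expeRD.
    by rewrite -expeR0 lee_expeR addeC sube_le0.
  move=> xr j; case: eqP => [->|]; last by rewrite mul0e.
  rewrite -[(expR _)%:E]/(expeR (- r%:E)) -expeRD.
  by rewrite -expeR0 lee_expeR addeC sube_le0.
have mid : measurable_fun setT (id : T -> n.-tuple (\bar R)).
  exact/measurable_fun_tnthP.
by move=> mB; have := mid measurableT _ mB; rewrite setTI.
Qed.

Lemma tuple_law_unique (m1 m2 : probability (n.-tuple (\bar R)) R) :
  (forall c, (forall i, 0 <= c i)%R -> m1 (exp_box c) = m2 (exp_box c)) ->
  forall B, measurable B -> m1 B = m2 B.
Proof.
move=> m12 B /exp_boxes_generate; apply: probability_unique.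
- by move=> _ [c _ <-]; exact: measurable_exp_box.
- move=> _ _ [c c0 <-] [c' c'0 <-]; exists (fun i => Num.max (c i) (c' i)).
    by move=> i /=; rewrite le_max c0.
  by rewrite exp_boxI.
- exists (fun=> 0%R) => //; apply/seteqP; split => // x _ i.
  by rewrite mul0e.
- by move=> _ [c c0 <-]; exact: m12.
Qed.

End exponential_boxes.

(** * Tilting *)
Section tilted.
Context d (W : measurableType d) (R : realType) (P : probability W R).
Variable g : W -> \bar R.
Hypotheses (mg : measurable_fun setT g) (g0 : forall w, 0 <= g w).
Hypothesis goo : forall w, g w < +oo.
Hypothesis intg : \int[P]_w g w = 1.

Definition density_set (A : set W) : \bar R := \int[P]_(w in A) g w.

Let density0 : density_set set0 = 0.
Proof. exact: integral_set0. Qed.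

Let density_ge0 A : 0 <= density_set A.
Proof. exact: integral_ge0. Qed.

Let density_sigma_additive : semi_sigma_additive density_set.
Proof.
move=> F mF tF mUF; rewrite /density_set ge0_integral_bigcup//; last first.
  exact: measurable_funTS.
apply: is_cvg_nneseries => n _ _; exact: integral_ge0.
Qed.

Let density : {measure set W -> \bar R} := HB.pack density_set
  (isMeasure.Build _ W R density_set density0 density_ge0 density_sigma_additive).

Definition tilted : probability W R := HB.pack (Measure.sort density)
  (Measure_isProbability.Build _ W R density intg).

Lemma tiltedE A : tilted A = \int[P]_(w in A) g w.
Proof. by []. Qed.

Import HBNNSimple.

(** True for indicators by the definition of the tilted measure, hence for simple
    functions, hence for their monotone limits. *)
Lemma integral_tilted (f : W -> \bar R) : measurable_fun setT f ->
  (forall w, 0 <= f w) -> \int[tilted]_w f w = \int[P]_w (g w * f w).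
Proof.
move=> mf f0; pose h := nnsfun_approx measurableT mf.
transitivity (limn (fun n => \int[tilted]_w (h n w)%:E)).
  rewrite -monotone_convergence//.
  - apply: eq_integral => w _; apply/esym/cvg_lim => //.
    exact: cvg_nnsfun_approx.
  - by move=> n; exact/measurable_EFinP/measurable_funP.
  - by move=> n w _; rewrite lee_fin.
  - by move=> w _ m n mn; rewrite lee_fin; exact/lefP/nd_nnsfun_approx.
transitivity (limn (fun n => \int[P]_w (g w * (h n w)%:E))); last first.
  rewrite -monotone_convergence//.
  - apply: eq_integral => w _; apply/cvg_lim => //.
    by apply: cvgeZl; [rewrite ge0_fin_numE|exact: cvg_nnsfun_approx].
  - by move=> n; apply: emeasurable_funM => //; exact/measurable_EFinP/measurable_funP.
  - by move=> n w _; rewrite mule_ge0 ?lee_fin.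
  - by move=> w _ m n mn; rewrite lee_wpmul2l// lee_fin; exact/lefP/nd_nnsfun_approx.
congr (limn _); apply/funext => n.
transitivity (\int[tilted]_w
   (\sum_(y \in range (h n)) (y * \1_(h n @^-1` [set y]) w)%:E)).
  by apply: eq_integral => t tE; rewrite /= fimfunE -fsumEFin.
have indich r : measurable_fun setT (fun x => (r * \1_(h n @^-1` [set r]) x)%:E).
  by apply/measurable_EFinP/measurable_funM.
rewrite ge0_integral_fsum//; last by move=> m y Ey; exact: nnfun_muleindic_ge0.
transitivity (\int[P]_w (\sum_(y \in range (h n))
    g w * (y * \1_(h n @^-1` [set y]) w)%:E)); last first.
  apply: eq_integral => w _; rewrite -ge0_mule_fsumr => [|y]; last exact: nnfun_muleindic_ge0.
  by rewrite fsumEFin // -(fimfunE _ w).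
rewrite ge0_integral_fsum//; last 2 first.
  - by move=> y; apply: emeasurable_funM.
  - by move=> m y Ey; rewrite mule_ge0 // nnfun_muleindic_ge0.
apply: eq_fsbigr => r rhn.
under eq_integral do rewrite EFinM.
rewrite integralZl_indic_nnsfun => //.
under [RHS]eq_integral do rewrite EFinM muleCA.
rewrite ge0_integralZl//.
- rewrite integral_indic// setIT.
  rewrite -[X in _ * X = _]/(\int[P]_(w in h n @^-1` [set r]) g w).
  rewrite [X in _ * X = _]integral_mkcond.
  by congr (_ * _); apply: eq_integral => w _; rewrite epatch_indic.
- by apply: emeasurable_funM => //; exact/measurable_EFinP.
- by move=> t _; rewrite mule_ge0 ?lee_fin.
- by move: rhn; rewrite inE => -[t _ <-]; rewrite lee_fin.
Qed.

End tilted.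

Lemma measurable_map_tuple d (W : measurableType d) (R : realType)
    (X : R -> W -> \bar R) n (t : n.-tuple R) :
  (forall s, s \in t -> measurable_fun setT (X s)) ->
  measurable_fun setT (fun w => map_tuple (X ^~ w) t).
Proof.
move=> mX; apply/measurable_fun_tnthP => i.
rewrite (_ : _ \o _ = X (tnth t i)); first exact/mX/mem_tnth.
by apply/funext => w /=; rewrite tnth_map.
Qed.

(** A path is rebuilt from its values at the points of J, with an arbitrary value
    elsewhere; events depending on J do not see the difference. *)
Lemma depends_on_tuple (K : choiceType) (R : realType) (J : seq K)
    (A : set (paths K (\bar R))) : measurable A -> depends_on J A ->
  exists2 B : set ((size J).-tuple (\bar R)), measurable B &
    A = [set f | B (map_tuple f (in_tuple J))].
Proof.
move=> mA dA.
pose ext (x : (size J).-tuple (\bar R)) : paths K (\bar R) :=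
  fun k => nth +oo x (index k J).
exists (ext @^-1` A).
  rewrite -[X in measurable X]setTI; suff : measurable_fun setT ext by exact.
  apply: measurable_to_paths => k; rewrite /ext.
  have [kJ|kJ] := boolP (k \in J).
    move: (kJ); rewrite -index_mem => kJ'.
    rewrite (_ : (fun _ => _) = fun x => tnth x (Ordinal kJ')).
      exact: measurable_tnth.
    by apply/funext => x; rewrite (tnth_nth +oo).
  rewrite (_ : (fun _ => _) = fun=> +oo); first exact: measurable_cst.
  by apply/funext => x; rewrite nth_default// size_tuple memNindex.
have extE f : {in J, f =1 ext (map_tuple f (in_tuple J))}.
  by move=> k kJ; rewrite /ext (nth_map k) ?index_mem// nth_index.
by apply/seteqP; split => f /=; apply: dA => k kJ; rewrite -extE.
Qed.

(** A process takes values in [-oo, +oo[ at every point of its space, while a law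
    on the path space only excludes +oo almost surely at each time. *)
Definition finite_part (R : realType) (x : \bar R) : \bar R := if x == +oo then 0 else x.

Lemma finite_part_lty (R : realType) (x : \bar R) : finite_part x < +oo.
Proof. by rewrite /finite_part; case: x => [r| |]; rewrite ?eqxx ?ltry// ltNyr. Qed.

Lemma finite_part_id (R : realType) (x : \bar R) : x < +oo -> finite_part x = x.
Proof. by rewrite /finite_part; case: ifP => // /eqP ->. Qed.

Lemma measurable_finite_part (R : realType) : measurable_fun setT (@finite_part R).
Proof.
apply: measurable_fun_ifT => //.
by apply: measurable_fun_eqe.
Qed.

(** * Expected maxima determine the tilted increments *)
Section max_derivative.
Context d (W : measurableType d) (R : realType) (P : probability W R).
Variables u M : W -> R.
Hypotheses (u0 : forall w, (0 <= u w)%R) (M0 : forall w, (0 <= M w)%R).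
Hypotheses (iu : P.-integrable setT (EFin \o u)).
Hypotheses (iM : P.-integrable setT (EFin \o M)).

Let mu : measurable_fun setT u.
Proof. exact/measurable_EFinP/(measurable_int _ iu). Qed.
Let mM : measurable_fun setT M.
Proof. exact/measurable_EFinP/(measurable_int _ iM). Qed.

Definition scaled_max (c : R) : \bar R := \int[P]_w (Num.max (c * u w) (M w))%:E.

Let integrable_max (c : R) : (0 <= c)%R ->
  P.-integrable setT (fun w => (Num.max (c * u w) (M w))%:E).
Proof.
move=> c0; have : P.-integrable setT (fun w => c%:E * (u w)%:E + (M w)%:E).
  by apply: integrableD => //; exact: integrableZl.
apply: le_integrable => //.
  by apply/measurable_EFinP/measurable_maxr => //; exact: measurable_funM.
move=> w _; rewrite -EFinM -EFinD !abse_EFin lee_fin.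
rewrite !ger0_norm ?le_max ?addr_ge0 ?mulr_ge0// ?M0 ?orbT//.
by rewrite ge_max lerDl lerDr M0 mulr_ge0.
Qed.

(** The difference quotient with increment 1/(n+1) of c |-> max(c u, M) at
   c = 1. *)
Let quotient n w : R :=
  (n.+1%:R * (Num.max ((1 + n.+1%:R^-1) * u w) (M w) - Num.max (1 * u w) (M w)))%R.

Let quotient_bounds n w : (0 <= quotient n w <= u w)%R.
Proof.
rewrite /quotient mul1r; set c := (_ * u w)%R.
have n0 : (0 < n.+1%:R :> R)%R by rewrite ltr0n.
have -> : c = (u w + u w / n.+1%:R)%R by rewrite /c mulrDl mul1r mulrC [X in (_ + X)%R]mulrC.
have un0 : (0 <= u w / n.+1%:R)%R by rewrite divr_ge0.
apply/andP; split; first by rewrite mulr_ge0 ?ler0n// subr_ge0 ge_max !le_max lexx lerDl un0 orbT.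
have le_un : (Num.max (u w + u w / n.+1%:R) (M w) <= u w / n.+1%:R + Num.max (u w) (M w))%R.
  rewrite ge_max [X in (X <= _)%R]addrC lerD2l le_max lexx/=.
  by rewrite (@le_trans _ _ (Num.max (u w) (M w)))// ?lerDr// le_max lexx orbT.
rewrite (@le_trans _ _ (n.+1%:R * (u w / n.+1%:R)))%R//.
  by rewrite ler_pM2l// lerBlDr.
by rewrite mulrCA divff ?mulr1// gt_eqF.
Qed.

Let quotient_cvg w : (quotient n w)%:E @[n --> \oo] -->
  (if (M w <= u w)%R then (u w)%:E else 0).
Proof.
case: ifPn => [Mu|]; last rewrite -ltNge => uM.
  apply: cvg_near_cst; near=> n; congr EFin; rewrite /quotient mul1r.
  rewrite (max_idPl Mu) (max_idPl _); first by field.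
  by rewrite (le_trans Mu)// ler_peMl// lerDl invr_ge0.
apply: cvg_near_cst; near=> n; congr EFin; rewrite /quotient mul1r.
rewrite (max_idPr (ltW uM)) (max_idPr _) ?subrr ?mulr0//.
have n0 : (0 < n.+1%:R :> R)%R by rewrite ltr0n.
rewrite mulrDl mul1r -lerBrDl mulrC ler_pdivrMr// mulrC -ler_pdivrMr ?subr_gt0//.
rewrite (@le_trans _ _ n%:R)// ?ler_nat//.
by near: n; exact: nbhs_infty_ger.
Unshelve. all: by end_near. Qed.

(** The function c |-> max(c u, M) is convex with slopes between 0 and u, and its
    right derivative at 1 is u where M <= u and 0 where M > u; dominated
    convergence exchanges derivative and expectation. The right derivative is
    the one which counts the event M = u. *)
Lemma scaled_max_derivative :
  (fun n : nat => n.+1%:R%:E * (scaled_max (1 + n.+1%:R^-1) - scaled_max 1)) @ \oo -->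
  \int[P]_w (if (M w <= u w)%R then (u w)%:E else 0).
Proof.
have mq n : measurable_fun setT (fun w => (quotient n w)%:E).
  apply/measurable_EFinP/measurable_funM => //; apply: measurable_funB;
  by apply: measurable_maxr => //; exact: measurable_funM.
have [|||_ _] := @dominated_convergence _ _ _ P setT measurableT _
    (fun w => if (M w <= u w)%R then (u w)%:E else 0) _ mq _ _ iu _.
- apply: (emeasurable_fun_cvg _ _ mq) => w _; exact: quotient_cvg.
- by apply: aeW => w _; exact: quotient_cvg.
- apply: aeW => w n _ /=; rewrite lee_fin ger0_norm; by have /andP[] := quotient_bounds n w.
apply: cvg_trans; apply: near_eq_cvg; apply: nearW => n.
rewrite -integralB_EFin//; last 2 first.
- exact: integrable_max.
- exact: integrable_max.
rewrite -integralZl//.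
by apply: integrableB => //; exact: integrable_max.
Qed.

End max_derivative.

Section weighted_max.
Context (R : realType) (n : nat).
Implicit Types (c : 'I_n -> R) (x : n.-tuple (\bar R)).

Definition weighted_max c x : \bar R :=
  \big[maxe/0]_(i < n) ((c i)%:E * expeR (tnth x i)).

Lemma weighted_max_ge0 c x : 0 <= weighted_max c x.
Proof. by rewrite /weighted_max; exact: bigmax_ge_id. Qed.

Lemma weighted_max_le c x y : 0 <= y ->
  (weighted_max c x <= y) <-> (forall i, (c i)%:E * expeR (tnth x i) <= y).
Proof.
move=> y0; split=> [/bigmax_leP[_ xy] i|xy]; first exact: xy.
exact/bigmax_leP.
Qed.

Lemma weighted_max_lty c x : (forall i, tnth x i < +oo) -> weighted_max c x < +oo.
Proof.
move=> xoo; apply: bigmax_lt; rewrite ?ltry// => i _.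
by case: (tnth x i) (xoo i) => [r|//|] _; rewrite /= ?mule0 -?EFinM ltry.
Qed.

Lemma weighted_max_le_sum c x : (forall i, (0 <= c i)%R) ->
  weighted_max c x <= \sum_(i < n) (c i)%:E * expeR (tnth x i).
Proof.
move=> c0.
have h i : 0 <= (c i)%:E * expeR (tnth x i) by rewrite mule_ge0 ?lee_fin ?expeR_ge0.
apply: bigmax_le => [|i _]; first exact: sume_ge0.
by rewrite [X in _ <= X](bigD1 i)//= leeDl// sume_ge0.
Qed.

Lemma measurable_weighted_max c : measurable_fun setT (weighted_max c).
Proof.
rewrite /weighted_max; elim: (index_enum _) => [|i r ih].
  by under eq_fun do rewrite big_nil; exact: measurable_cst.
under eq_fun do rewrite big_cons; apply: measurable_maxe => //.
apply: (@measurableT_comp _ _ _ _ _ _ (fun x : \bar R => (c i)%:E * expeR x)).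
  exact: measurable_scaled_expeR.
exact: measurable_tnth.
Qed.

End weighted_max.

Definition cons_weight (R : realType) n (c0 : R) (c : 'I_n -> R) (i : 'I_n.+1) : R :=
  oapp c c0 (unlift ord0 i).

Lemma weighted_max_cons (R : realType) n (c0 : R) (c : 'I_n -> R)
    (y : \bar R) (x : n.-tuple (\bar R)) :
  weighted_max (cons_weight c0 c) [tuple of y :: x] =
  maxe (c0%:E * expeR y) (weighted_max c x).
Proof.
rewrite /weighted_max big_ord_recl /cons_weight unlift_none/= tnth0.
by congr maxe; apply: eq_bigr => i _; rewrite liftK/= tnthS.
Qed.

Definition increments (R : realType) n (y : \bar R) (x : n.-tuple (\bar R)) :
  n.-tuple (\bar R) := map_tuple (fun z => z - y) x.

(** The event whose indicator appears in the derivative of the expected maximum is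
    a box event for the increments. *)
Lemma exp_box_increments (R : realType) n (c : 'I_n -> R) (y : R)
    (x : n.-tuple (\bar R)) :
  exp_box c (increments y%:E x) <-> weighted_max c x <= expeR y%:E.
Proof.
rewrite weighted_max_le ?expeR_ge0//.
have h i : ((c i)%:E * expeR (tnth (increments y%:E x) i) <= 1) =
           ((c i)%:E * expeR (tnth x i) <= expeR y%:E).
  rewrite tnth_map expeRD -EFinN /= expRN muleA lee_pdivrMr ?expR_gt0//.
  by rewrite mul1e.
by split => hx i; [rewrite -h|rewrite h]; exact: hx.
Qed.

Lemma measurable_increments d (W : measurableType d) (R : realType) n
    (U : W -> \bar R) (X : W -> n.-tuple (\bar R)) :
  measurable_fun setT U -> measurable_fun setT X ->
  measurable_fun setT (fun w => increments (U w) (X w)).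
Proof.
move=> mU mX; apply/measurable_fun_tnthP => i.
rewrite (_ : _ \o _ = fun w => tnth (X w) i - U w).
  apply: emeasurable_funB => //.
  exact: measurableT_comp (@measurable_tnth _ _ _ i) mX.
by apply/funext => w /=; rewrite tnth_map.
Qed.

Lemma integral_weighted_max_lty d (W : measurableType d) (R : realType)
    (P : probability W R) n (X : W -> n.-tuple (\bar R)) (c : 'I_n -> R) :
  measurable_fun setT X -> (forall i, (0 <= c i)%R) ->
  (forall i, \int[P]_w expeR (tnth (X w) i) < +oo) ->
  \int[P]_w weighted_max c (X w) < +oo.
Proof.
move=> mX c0 intX.
have mexp i : measurable_fun setT (fun w => expeR (tnth (X w) i)).
  apply: measurableT_comp; first exact: measurable_expeR.
  exact: measurableT_comp (@measurable_tnth _ _ _ i) mX.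
apply: (@le_lt_trans _ _ (\int[P]_w \sum_(i < n) (c i)%:E * expeR (tnth (X w) i))).
  apply: ge0_le_integral => //.
  - by move=> w _; exact: weighted_max_ge0.
  - exact: measurableT_comp (@measurable_weighted_max _ _ c) mX.
  - by apply: emeasurable_sum => i; exact: measurable_funeM.
  - by move=> w _; exact: weighted_max_le_sum.
rewrite ge0_integral_sum//; last 2 first.
- by move=> i; exact: measurable_funeM.
- by move=> i w _; rewrite mule_ge0 ?lee_fin ?expeR_ge0.
apply: lte_sum_pinfty => i _.
rewrite ge0_integralZl ?lee_fin//; last by move=> w _; exact: expeR_ge0.
by apply: lte_mul_pinfty => //; rewrite lee_fin.
Qed.

Section tilt_determined.
Context (R : realType) (n : nat).

Section one_space.
Context d (W : measurableType d) (P : probability W R).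
Variables (U : W -> \bar R) (X : W -> n.-tuple (\bar R)).
Hypotheses (mU : measurable_fun setT U) (mX : measurable_fun setT X).
Hypotheses (Uoo : forall w, U w < +oo) (Xoo : forall w i, tnth (X w) i < +oo).
Hypotheses (intU : \int[P]_w expeR (U w) = 1).
Hypotheses (intX : forall i, \int[P]_w expeR (tnth (X w) i) < +oo).

Definition tilt : probability W R :=
  tilted (measurableT_comp (@measurable_expeR R) mU) (fun w => expeR_ge0 _) intU.

Let expU_fin w : expeR (U w) \is a fin_num.
Proof.
by rewrite ge0_fin_numE ?expeR_ge0// -[+oo]/(expeR +oo) lte_expeR.
Qed.

Let max_fin c w : weighted_max c (X w) \is a fin_num.
Proof. by rewrite ge0_fin_numE ?weighted_max_ge0// weighted_max_lty. Qed.

Let measurable_max c : measurable_fun setT (fun w => weighted_max c (X w)).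
Proof. exact: measurableT_comp (@measurable_weighted_max _ _ c) mX. Qed.

(** The derivative of the expected maximum, with u = e^U and with M the weighted
    maximum of the e^(X_j). Where U = -oo, u = 0 and both sides vanish. *)
Lemma tilt_exp_box_cvg c : (forall i, (0 <= c i)%R) ->
  (fun k : nat => k.+1%:R%:E *
    (\int[P]_w maxe ((1 + k.+1%:R^-1)%:E * expeR (U w)) (weighted_max c (X w)) -
     \int[P]_w maxe (1%:E * expeR (U w)) (weighted_max c (X w)))) @ \oo -->
  tilt [set w | exp_box c (increments (U w) (X w))].
Proof.
move=> c0; pose u w := fine (expeR (U w)); pose M w := fine (weighted_max c (X w)).
have uE w : (u w)%:E = expeR (U w) by rewrite fineK.
have ME w : (M w)%:E = weighted_max c (X w) by rewrite fineK.
have iu : P.-integrable setT (EFin \o u).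
  apply/integrableP; split.
    rewrite (_ : _ \o _ = @expeR R \o U); last by apply/funext => w /=; rewrite uE.
    exact: measurableT_comp (@measurable_expeR R) mU.
  rewrite (eq_integral (fun w => expeR (U w))) ?intU ?ltry// => w _.
  by rewrite /= ger0_norm ?fine_ge0 ?expeR_ge0.
have iM : P.-integrable setT (EFin \o M).
  apply/integrableP; split.
    by rewrite (_ : _ \o _ = fun w => weighted_max c (X w)) //; apply/funext => w /=; rewrite ME.
  rewrite (eq_integral (fun w => weighted_max c (X w))) ?integral_weighted_max_lty// => w _.
  by rewrite /= ger0_norm ?fine_ge0 ?weighted_max_ge0.
have := scaled_max_derivative (fun w => fine_ge0 (expeR_ge0 _))
  (fun w => fine_ge0 (weighted_max_ge0 _ _)) iu iM.
rewrite (_ : tilt _ = \int[P]_w (if (M w <= u w)%R then (u w)%:E else 0)); last first.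
  rewrite /tilt tiltedE integral_mkcond; apply: eq_integral => w _.
  rewrite patchE -[(expeR \o U) w]/(expeR (U w)) -[point]/(0 : \bar R).
  rewrite -lee_fin ME uE; case E: (U w) (Uoo w) => [y|//|] _; last first.
    by rewrite /= !if_same.
  have [yx|yx] := pselect (weighted_max c (X w) <= expeR y%:E).
    by rewrite yx ifT// inE/= E; exact/exp_box_increments.
  rewrite (negbTE (introN idP yx)) ifF//; apply/negP; rewrite inE/= E.
  by move=> /exp_box_increments.
have smE a : scaled_max P u M a =
    \int[P]_w maxe (a%:E * expeR (U w)) (weighted_max c (X w)).
  by apply: eq_integral => w _; rewrite EFin_max EFinM uE ME.
by rewrite !smE; under eq_fun do rewrite smE.
Qed.

End one_space.

(** The two derivatives are limits of the same difference quotients, so the tilted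
    increments have the same probabilities on boxes, which determine the
    law. *)
Lemma tilt_determined d (W : measurableType d) (P : probability W R)
    (U : W -> \bar R) (X : W -> n.-tuple (\bar R))
    (mU : measurable_fun setT U) (mX : measurable_fun setT X)
    (Uoo : forall w, U w < +oo) (Xoo : forall w i, tnth (X w) i < +oo)
    (intU : \int[P]_w expeR (U w) = 1)
    (intX : forall i, \int[P]_w expeR (tnth (X w) i) < +oo)
    d' (W' : measurableType d') (P' : probability W' R)
    (U' : W' -> \bar R) (X' : W' -> n.-tuple (\bar R))
    (mU' : measurable_fun setT U') (mX' : measurable_fun setT X')
    (Uoo' : forall w, U' w < +oo) (Xoo' : forall w i, tnth (X' w) i < +oo)
    (intU' : \int[P']_w expeR (U' w) = 1)
    (intX' : forall i, \int[P']_w expeR (tnth (X' w) i) < +oo) :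
  (forall c0 c, (0 <= c0)%R -> (forall i, 0 <= c i)%R ->
    \int[P]_w maxe (c0%:E * expeR (U w)) (weighted_max c (X w)) =
    \int[P']_w maxe (c0%:E * expeR (U' w)) (weighted_max c (X' w))) ->
  forall B, measurable B ->
    tilt mU intU [set w | B (increments (U w) (X w))] =
    tilt mU' intU' [set w | B (increments (U' w) (X' w))].
Proof.
move=> eqL B mB.
have minc := measurable_increments mU mX.
have minc' := measurable_increments mU' mX'.
apply: (tuple_law_unique (m1 := image_law (tilt mU intU) minc)
  (m2 := image_law (tilt mU' intU') minc')) mB => c c0.
have cv := tilt_exp_box_cvg (mU := mU) mX Uoo Xoo (intU := intU) intX c0.
have cv' := tilt_exp_box_cvg (mU := mU') mX' Uoo' Xoo' (intU := intU') intX' c0.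
transitivity (tilt mU intU [set w | exp_box c (increments (U w) (X w))]) => //.
rewrite -(cvg_lim (@ereal_hausdorff R) cv) -[RHS](cvg_lim (@ereal_hausdorff R) cv').
congr (limn _); apply/funext => k; rewrite !eqL// addr_ge0// invr_ge0//.
Qed.

End tilt_determined.

(** * Slabs of the Poisson process *)
Section gumbel.
Context (R : realType).

Lemma gumbel_intensity_ray (a : R) :
  gumbel_intensity `]a, +oo[ = (expR (- a))%:E.
Proof.
have cexpN : continuous (fun z : R => expR (- z)).
  by move=> z; apply: continuous_comp; [exact: opp_continuous|exact: continuous_expR].
have mexpN : measurable_fun setT (fun z : R => (expR (- z))%:E).
  by apply/measurable_EFinP; exact: measurableT_comp.
rewrite /gumbel_intensity integral_itv_obnd_cbnd; last exact: measurable_funTS.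
rewrite (@ge0_continuous_FTC2y R (fun x => expR (- x)) (fun x => - expR (- x))%R a 0%R).
- by rewrite sub0e -EFinN opprK.
- by move=> x _; exact: expR_ge0.
- by apply: continuous_subspaceT.
- rewrite -oppr0; apply: cvgN; exact: cvgr_expR.
- by move=> x _; exact: ex_derive.
- by apply: cvgN; apply/cvg_at_right_filter; exact: cexpN.
- move=> x _; rewrite derive1_comp// derive1N// derive1_id mulN1r derive1_comp//.
  rewrite [in LHS]derive1E.
  have /funeqP -> := @derive_expR R.
  by rewrite derive1N// derive1_id mulrN1 opprK.
Qed.

(** In the variable u = e^(-p) the intensity e^(-p) dp is Lebesgue measure on
    ]0, +oo[; slabs are the intervals of length e in this variable. *)
Definition slab (e : R) (k : nat) : set R :=
  [set p | k%:R * e <= expR (- p) < k.+1%:R * e]%R.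

Let level (e : R) (k : nat) : set R := [set p | expR (- p) < k%:R * e]%R.

Let levelE (e : R) (k : nat) : (0 < e)%R ->
  level e k.+1 = `](- ln (k.+1%:R * e))%R, +oo[%classic.
Proof.
move=> e0; have lE p : (expR (- p) < k.+1%:R * e)%R = (- ln (k.+1%:R * e) < p)%R.
  by rewrite ltrNl -[RHS]ltr_expR lnK// posrE mulr_gt0.
by apply/seteqP; split => p; rewrite /level/= in_itv/= andbT lE.
Qed.

Lemma measurable_slab (e : R) (k : nat) : measurable (slab e k).
Proof.
rewrite (_ : slab e k = (fun p => expR (- p)) @^-1` `[k%:R * e, k.+1%:R * e[%classic)%R.
  rewrite -[X in measurable X]setTI; suff : measurable_fun setT (fun p : R => expR (- p)).
    by apply.
  exact: measurableT_comp.
by apply/seteqP; split => p; rewrite /= in_itv.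
Qed.

Lemma gumbel_intensity_slab (e : R) (k : nat) : (0 < e)%R ->
  gumbel_intensity (slab e k) = e%:E.
Proof.
move=> e0.
have levelI j : gumbel_intensity (level e j.+1) = (j.+1%:R * e)%:E.
  by rewrite levelE// gumbel_intensity_ray opprK lnK// posrE mulr_gt0.
case: k => [|k].
  rewrite (_ : slab e 0 = level e 1) ?levelI ?mul1r//.
  by apply/seteqP; split => p; rewrite /slab /level/= mul0r expR_ge0.
have : gumbel_intensity (level e k.+2) =
    gumbel_intensity (slab e k.+1) + gumbel_intensity (level e k.+1).
  rewrite /gumbel_intensity -ge0_integral_setU//.
  - congr (integral _ _ _); apply/seteqP; split => p; rewrite /slab /level/=.
      by move=> pk; have [?|?] := leP (k.+1%:R * e)%R (expR (- p)); [left|right].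
    move=> [/andP[]//|/lt_trans]; apply; rewrite ltr_pM2r// ltr_nat//.
  - exact: measurable_slab.
  - by rewrite levelE.
  - apply/measurable_EFinP; apply: measurable_funTS; exact: measurableT_comp.
  - rewrite disj_set2E; apply/eqP/seteqP; split => // p [/andP[kp _]].
    by move=> /(le_lt_trans kp); rewrite ltxx.
rewrite !levelI => /(congr1 (fun y => y - (k.+1%:R * e)%:E)); rewrite addeK// => <-.
by rewrite -EFinB -mulrBl -natrB// subSnn mul1r.
Qed.

End gumbel.

(** The exponential series of g * rate. *)
Lemma poisson_generating_function (R : realType) (rate g : R) :
  (0 < rate)%R -> (0 <= g)%R ->
  \sum_(m <oo) (g ^+ m)%:E * poisson_prob rate 0 [set m] =
  (expR (- (rate * (1 - g))))%:E.
Proof.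
move=> rate0 g0.
rewrite (_ : expR _ = expR (- rate) * expR (g * rate))%R; last first.
  by rewrite -expRD; congr expR; ring.
under eq_eseriesr.
  move=> m _; rewrite /poisson_prob rate0 esum_set1 ?lee_fin ?poisson_pmf_ge0//.
  rewrite /poisson_pmf rate0 -EFinM mulrA mulrA -exprMn mulrC EFinM; over.
rewrite /= nneseriesZl/=; last first.
  by move=> n _; rewrite lee_fin divr_ge0// exprn_ge0// mulr_ge0// ltW.
rewrite EFinM; congr *%E; rewrite expRE -EFin_lim; last first.
  rewrite /pseries/=; under eq_fun do rewrite mulrC.
  exact: is_cvg_series_exp_coeff.
apply/congr_lim/funext => n/=; rewrite /pseries/= /series/= -sumEFin//.
by under eq_bigr do rewrite mulrC.
Qed.

(** * Products over the slabs *)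

(** Independence of finitely many variables with values in nat, stated through
    their level sets alone. *)
Section independent_product.
Context d (V : measurableType d) (R : realType) (Q : probability V R) (K : nat).
Variables (X : nat -> V -> nat) (a : nat -> nat -> R).
Hypothesis mX : forall k m, measurable (X k @^-1` [set m]).
Hypothesis a01 : forall k m, (0 <= a k m <= 1)%R.

Definition level_sets (E : nat -> set V) :=
  forall k, (E k = setT) \/ (exists m, E k = X k @^-1` [set m]).

Hypothesis indep : forall E, level_sets E ->
  Q (\bigcap_(k in [set k | (k < K)%N]) E k) = \prod_(0 <= k < K) Q (E k).

Let a0 k m : (0 <= a k m)%R. Proof. by have /andP[] := a01 k m. Qed.
Let a1 k m : (a k m <= 1)%R. Proof. by have /andP[] := a01 k m. Qed.

Let measurable_aX k : measurable_fun setT (fun v => a k (X k v)).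
Proof.
move=> _ B _; rewrite setTI.
rewrite (_ : _ @^-1` _ = \bigcup_(m in [set m | B (a k m)]) (X k @^-1` [set m])).
  by apply: bigcup_measurable => m _; exact: mX.
by apply/seteqP; split => [v Bv|v [m /= Bm ->]]//; exists (X k v).
Qed.

Let measurable_level E : level_sets E -> forall k, measurable (E k).
Proof. by move=> sE k; case: (sE k) => [->//|[m ->]]. Qed.

Let tail (E : nat -> set V) (j : nat) : set V :=
  \bigcap_(k in [set k | (j <= k < K)%N]) E k.

Let measurable_tail E j : level_sets E -> measurable (tail E j).
Proof.
by move=> sE; apply: bigcap_measurableType => k _; exact: measurable_level.
Qed.

Let mean k : \bar R := \int[Q]_v (a k (X k v))%:E.

Lemma mean_le1 k : mean k <= 1.
Proof.
rewrite /mean -(probability_setT Q) -[X in _ <= X]mul1e -integral_cst//.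
apply: ge0_le_integral => //.
- by move=> v _; rewrite lee_fin.
- exact/measurable_EFinP.
- by move=> v _; rewrite lee_fin.
Qed.

Let mean_ge0 k : 0 <= mean k.
Proof. by apply: integral_ge0 => v _; rewrite lee_fin. Qed.

Let integral_level j (D : set V) (f : V -> R) : measurable D ->
  measurable_fun setT f -> (forall v, 0 <= f v)%R ->
  \int[Q]_(v in D) (f v * a j (X j v))%:E =
  \sum_(m <oo) (a j m)%:E * \int[Q]_(v in D `&` X j @^-1` [set m]) (f v)%:E.
Proof.
move=> mD mf f0.
have DE : D = \bigcup_m (D `&` X j @^-1` [set m]).
  by apply/seteqP; split => [v Dv|v [m _ []]]//; exists (X j v).
have mfE A : measurable_fun A (fun v => (f v)%:E).
  by apply/measurable_EFinP; exact: measurable_funTS.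
rewrite {1}DE ge0_integral_bigcup//=.
- apply: eq_eseriesr => m _; rewrite -ge0_integralZl ?lee_fin//.
  + apply: eq_integral => v /set_mem[_ /= ->].
    by rewrite EFinM muleC.
  + exact: measurableI.
  + by move=> v _; rewrite lee_fin.
- by move=> m; exact: measurableI.
- rewrite -DE; apply/measurable_EFinP; apply: measurable_funTS.
  exact: measurable_funM.
- by move=> v _; rewrite lee_fin mulr_ge0.
- by move=> m m' _ _ [v [[_ /= <-] [_ <-]]].
Qed.

Let meanE j : mean j = \sum_(m <oo) (a j m)%:E * Q (X j @^-1` [set m]).
Proof.
rewrite /mean; under eq_integral do rewrite -[a j _]mul1r.
rewrite (integral_level _ _ (f := cst 1%R))//.
apply: eq_eseriesr => m _.
by rewrite setTI -[X in _ * X]/(\int[Q]_(v in X j @^-1` [set m]) cst 1 v) integral_cst ?mul1e.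
Qed.

(** Interpolates between the product rule for events (j = 0) and the one for
   expectations (j = K). Each step replaces the event E j by the sum over m of
   the events X j = m, weighted by a j m. *)
Let integral_tail j E : (j <= K)%N -> level_sets E ->
  \int[Q]_(v in tail E j) (\prod_(0 <= k < j) a k (X k v))%:E =
  \prod_(j <= k < K) Q (E k) * \prod_(0 <= k < j) mean k.
Proof.
elim: j E => [|j ih] E jK sE.
  under eq_integral do rewrite big_nil.
  rewrite integral_cst ?mul1e ?big_nil ?mule1//; last exact: measurable_tail.
  by rewrite -indep.
pose E' m k := if k == j then X j @^-1` [set m] else E k.
have sE' m : level_sets (E' m).
  by move=> k; rewrite /E'; case: eqP => [->|]; [right; exists m|].
have tailE' m : tail (E' m) j = tail E j.+1 `&` X j @^-1` [set m].
  apply/seteqP; split => v.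
    move=> Ev; split => [k /= /andP[jk kK]|].
      have := Ev k; rewrite /E' /= (ltnW jk) kK gtn_eqF//; exact.
    by have := Ev j; rewrite /E' /= eqxx leqnn; exact.
  move=> [Ev Xv] k /= /andP[jk kK]; rewrite /E'; case: eqP => [_//|/eqP kj].
  by apply: Ev; rewrite /= kK ltn_neqAle eq_sym kj jk.
under eq_integral do rewrite big_nat_recr//=.
rewrite integral_level; last 3 first.
- exact: measurable_tail.
- by apply: measurable_prod => k _; exact: measurable_aX.
- by move=> v; apply: prodr_ge0 => k _.
have prodE' m : \prod_(j <= k < K) Q (E' m k) =
    Q (X j @^-1` [set m]) * \prod_(j.+1 <= k < K) Q (E k).
  rewrite big_ltn// /E' eqxx; congr (_ * _).
  by rewrite !big_nat; apply: eq_bigr => k /andP[jk _]; rewrite gtn_eqF.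
pose c := \prod_(j.+1 <= k < K) Q (E k) * \prod_(0 <= k < j) mean k.
have c_fin : c \is a fin_num.
  rewrite fin_numM//; apply/prode_fin_num => k _.
    by rewrite fin_num_measure//; exact: measurable_level.
  by rewrite ge0_fin_numE// (le_lt_trans (mean_le1 k)) ?ltry.
under eq_eseriesr => m _.
  rewrite -tailE' ih//; last exact: ltnW.
  rewrite prodE' -muleA -/c -(fineK c_fin) muleA muleC; over.
rewrite nneseriesZl; last by move=> m _; rewrite mule_ge0 ?lee_fin.
by rewrite -meanE fineK// /c big_nat_recr//= muleA.
Qed.

Lemma integral_independent_prod :
  \int[Q]_v (\prod_(0 <= k < K) a k (X k v))%:E =
  \prod_(0 <= k < K) \int[Q]_v (a k (X k v))%:E.
Proof.
have := @integral_tail K (fun=> setT) (leqnn K) _.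
rewrite big_geq// mul1e /tail (_ : \bigcap_(k in _) _ = setT).
  by apply => k; left.
by apply/seteqP; split => // v _ k.
Qed.

Lemma integral_level_sets k :
  \int[Q]_v (a k (X k v))%:E =
  \sum_(m <oo) (a k m)%:E * Q (X k @^-1` [set m]).
Proof. exact: meanE. Qed.

End independent_product.

Lemma natr_dist_lt_half (R : realType) (p m : nat) :
  (`|m%:R - p%:R| < 2^-1 :> R)%R -> p = m.
Proof.
have half1 : (2^-1 < 1 :> R)%R by rewrite invf_lt1 ?ltr1n.
case: (ltngtP p m) => // pm; rewrite ltNge => /negP[]; apply: (le_trans (ltW half1)).
  by rewrite -natrB ?(ltnW pm)// normr_nat ler1n subn_gt0.
by rewrite distrC -natrB ?(ltnW pm)// normr_nat ler1n subn_gt0.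
Qed.

Lemma measurable_point_count d (V : measurableType d) (R : realType)
    (pts : nat -> V -> R) (B : set R) :
  (forall i, measurable_fun setT (pts i)) -> measurable B ->
  measurable_fun setT (point_count pts B).
Proof.
move=> mpts mB; apply: ge0_emeasurable_sum => [i v _ _|i _]; first by rewrite lee_fin.
have mi := @measurable_indic _ _ R setT _ mB.
by apply/measurable_EFinP/(measurableT_comp mi); exact: mpts.
Qed.
Section cell_product.
Context d (V : measurableType d) (R : realType) (Q : probability V R).
Variables (pts : nat -> V -> R) (e : R) (K : nat).
Hypothesis e0 : (0 < e)%R.
Hypothesis ppp : gumbel_poisson_process Q pts.

(** The index of the slab of p, where all the slabs from K on are merged into one
    cell with index K. That cell has infinite mass, and the other ones have mass
    e. *)
Definition cell (p : R) : nat := minn K (Num.truncn (expR (- p) / e)).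

Lemma cell_le p : (cell p <= K)%N.
Proof. exact: geq_minl. Qed.

Lemma cell_slab p k : (k < K)%N -> slab e k p <-> cell p = k.
Proof.
move=> kK; have pe0 : (0 <= expR (- p) / e)%R by rewrite divr_ge0 ?expR_ge0// ltW.
rewrite /slab/= -ler_pdivlMr// -ltr_pdivrMr// -truncn_eq//.
split => [/eqP tk|].
  by rewrite /cell tk; apply/minn_idPr/ltnW.
rewrite /cell /minn; case: ifP => [_ Kk|_ -> //]; by rewrite Kk ltnn in kK.
Qed.

(** The number of points in a slab is almost surely an integer; on the null set
    where it is +oo the value 0 is chosen. *)
Definition natval (x : \bar R) : nat := xget 0%N [set m : nat | x = m%:R%:E].

Lemma natvalE m : natval m%:R%:E = m.
Proof.
rewrite /natval; case: xgetP => [n _ /= [/eqP]|/(_ m)[]//].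
by rewrite eqr_nat => /eqP.
Qed.

Let non_nat : set (\bar R) := ~` \bigcup_(m : nat) [set m%:R%:E].

Let measurable_non_nat : measurable non_nat.
Proof. by apply/measurableC/bigcupT_measurable => m; exact: emeasurable_set1. Qed.

Let natval_preimage m : natval @^-1` [set m] =
  [set m%:R%:E] `|` (if m == 0%N then non_nat else set0).
Proof.
apply/seteqP; split => x.
  have [[k _ /= ->]|xN] := pselect ((\bigcup_(m : nat) [set m%:R%:E]) x).
    by rewrite natvalE => ->; left.
  rewrite /natval /=; case: xgetP => [k _ xk|_ <-]; last by right.
  by exfalso; apply: xN; exists k.
move=> [/= ->|]; first exact: natvalE.
case: eqP => // -> xN; rewrite /= /natval; case: xgetP => // k _ xk.
by exfalso; apply: xN; exists k.
Qed.

Lemma measurable_natval m : measurable (natval @^-1` [set m]).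
Proof.
rewrite natval_preimage; apply: measurableU; first exact: emeasurable_set1.
by case: ifP.
Qed.

Let slab_count k : V -> \bar R := point_count pts (slab e k).

Definition occupation k v : nat := natval (slab_count k v).

Let measurable_pts i : measurable_fun setT (pts i).
Proof. by case: ppp. Qed.

Let measurable_slab_count k : measurable_fun setT (slab_count k).
Proof. by apply: measurable_point_count => //; exact: measurable_slab. Qed.

Let slab_count_law k m : Q [set v | slab_count k v = m%:R%:E] =
  poisson_prob e 0 [set m].
Proof.
case: ppp => _ /(_ (slab e k) (measurable_slab e k)) + _ _.
by rewrite gumbel_intensity_slab// ltry => /(_ isT) ->.
Qed.

Let measurable_slab_count_eq k m : measurable [set v | slab_count k v = m%:R%:E].
Proof.
rewrite (_ : [set _ | _] = slab_count k @^-1` [set m%:R%:E])//.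
by rewrite -[X in measurable X]setTI; exact: measurable_slab_count.
Qed.

Let measurable_non_nat_count k : measurable (slab_count k @^-1` non_nat).
Proof. by rewrite -[X in measurable X]setTI; exact: measurable_slab_count. Qed.

Let slab_count_nat k : Q (slab_count k @^-1` non_nat) = 0.
Proof.
rewrite /non_nat -preimage_setC preimage_bigcup probability_setC; last first.
  by apply: bigcupT_measurable => m; exact: measurable_slab_count_eq.
rewrite measure_bigcup//=; last 2 first.
- by move=> m _; exact: measurable_slab_count_eq.
- move=> m m' _ _ [v [/= -> /eqP]].
  by rewrite eqe eqr_nat => /eqP.
rewrite [X in _ - X](_ : _ = 1) ?subee//.
rewrite (@eq_eseriesl _ _ xpredT); last by move=> m; rewrite in_setT.
have := poisson_generating_function e0 (@ler01 R).
rewrite subrr mulr0 oppr0 expR0 => <-; apply: eq_eseriesr => m _.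
by rewrite slab_count_law expr1n mul1e.
Qed.

Let occupation_law k m : Q (occupation k @^-1` [set m]) =
  poisson_prob e 0 [set m].
Proof.
rewrite -(slab_count_law k m) /occupation.
have -> : (fun v => natval (slab_count k v)) @^-1` [set m] =
   [set v | slab_count k v = m%:R%:E] `|` (if m == 0%N then slab_count k @^-1` non_nat else set0).
  rewrite -[LHS]/(slab_count k @^-1` (natval @^-1` [set m])) natval_preimage.
  by rewrite preimage_setU; congr (_ `|` _); case: ifP => //; rewrite preimage_set0.
case: ifP => _; last by rewrite setU0.
apply: measureU0; first exact: measurable_slab_count_eq.
  exact: measurable_non_nat_count.
exact: slab_count_nat.
Qed.

Let measurable_occupation k m : measurable (occupation k @^-1` [set m]).
Proof.
rewrite -[X in measurable X]setTI -[_ @^-1` _]/(slab_count k @^-1` (natval @^-1` [set m])).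
by apply: measurable_slab_count => //; exact: measurable_natval.
Qed.

Let slab_trivIset : trivIset setT (fun j : 'I_K => slab e j).
Proof.
move=> i j _ _ [p [/(cell_slab p (ltn_ord i)) pi /(cell_slab p (ltn_ord j)) pj]].
by apply: val_inj; rewrite /= -pi -pj.
Qed.

Lemma occupation_independent E : level_sets occupation E ->
  Q (\bigcap_(k in [set k | (k < K)%N]) E k) = \prod_(0 <= k < K) Q (E k).
Proof.
move=> EE; case: ppp => _ _ _ /(_ K (fun j => slab e j)).
move=> /(_ (fun j => measurable_slab e j) slab_trivIset).
pose J := [fset j | j in 'I_K]%fset.
move=> /(_ J (fun j => E j)) JE.
rewrite big_mkord; transitivity (Q (\bigcap_(k in [set` J]) E k)).
  congr (Q _); apply/seteqP; split => v Ev k kK; first exact: Ev (ltn_ord k).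
  by apply: (Ev (Ordinal kK)); apply/imfsetP; exists (Ordinal kK).
rewrite JE => [|j _].
  apply: perm_big; apply: uniq_perm; rewrite ?fset_uniq ?index_enum_uniq// => j.
  by rewrite mem_index_enum; apply/imfsetP; exists j.
case: (EE j) => [->|[m ->]].
  by exists setT => //; rewrite setTI preimage_setT.
by exists (natval @^-1` [set m]); [exact: measurable_natval|rewrite setTI].
Qed.

Let partial_count k N v : nat := \sum_(0 <= i < N) (cell (pts i v) == k).

Let partial_count_cvg v k : (k < K)%N -> ~ non_nat (slab_count k v) ->
  \forall N \near \oo, partial_count k N v = occupation k v.
Proof.
move=> kK /contrapT[m _ /= vm].
have cE N : \sum_(0 <= i < N) (\1_(slab e k) (pts i v) : R)%:E =
    (partial_count k N v)%:R%:E.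
  rewrite /partial_count natr_sum -sumEFin; apply: eq_bigr => i _.
  rewrite indicE; congr ((_ : bool)%:R%:E).
  by apply/idP/eqP => [/set_mem/(cell_slab _ kK)|/(cell_slab _ kK)/mem_set].
have : (partial_count k N v)%:R%:E @[N --> \oo] --> (m%:R%:E : \bar R).
  rewrite -vm /slab_count /point_count.
  under eq_fun do rewrite -cE.
  by apply: is_cvg_nneseries => i _ _; rewrite lee_fin.
move=> /fine_cvgP[_] /cvgrPdist_lt /(_ (2^-1)%R).
rewrite invr_gt0 ltr0n => /(_ isT); apply: filterS => N /=.
by rewrite /occupation vm natvalE; exact: natr_dist_lt_half.
Qed.

Lemma measurable_cell_preimage k : measurable (cell @^-1` [set k]).
Proof.
have [kK|Kk|->] := ltngtP k K.
- rewrite (_ : _ @^-1` _ = slab e k); first exact: measurable_slab.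
  by apply/seteqP; split => p /(cell_slab p kK).
- rewrite (_ : _ @^-1` _ = set0)//; apply/seteqP; split => // p /= pk.
  by have := cell_le p; rewrite pk leqNgt Kk.
- rewrite (_ : _ @^-1` _ = ~` \bigcup_(k in [set k | (k < K)%N]) slab e k).
    by apply/measurableC/bigcup_measurable => j _; exact: measurable_slab.
  apply/seteqP; split => p /=.
    by move=> pK [j jK /(cell_slab p jK) pj]; move: jK; rewrite -pj pK /= ltnn.
  move=> pN; apply/eqP; rewrite eqn_leq cell_le leqNgt; apply/negP => pK.
  by apply: pN; exists (cell p) => //; exact/cell_slab.
Qed.

Section limit.
Variable g : nat -> R.
Hypotheses (g01 : forall k, (0 <= g k <= 1)%R) (gK : g K = 1%R).

Let prod_cells N v : (\prod_(0 <= i < N) g (cell (pts i v)) =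
  \prod_(0 <= k < K) g k ^+ partial_count k N v)%R.
Proof.
rewrite /partial_count; under [RHS]eq_bigr do rewrite -prodrXr.
rewrite exchange_big/=; apply: eq_bigr => i _.
set c := cell _.
transitivity (\prod_(0 <= k < K | k == c) g k)%R.
  rewrite big_nat1_eq /=; case: ltnP => // Kc.
  by rewrite -gK; congr g; apply/eqP; rewrite eqn_leq cell_le.
rewrite big_mkcond; apply: eq_bigr => k _; rewrite eq_sym.
by case: eqP.
Qed.

Let measurable_prod_cells N :
  measurable_fun setT (fun v => (\prod_(0 <= i < N) g (cell (pts i v)))%:E).
Proof.
apply/measurable_EFinP; apply: measurable_prod => i _.
move=> _ B _; rewrite setTI.
rewrite (_ : _ @^-1` _ = \bigcup_(m in [set m | B (g m)]) (pts i @^-1` (cell @^-1` [set m]))).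
  apply: bigcup_measurable => m _; rewrite -[X in measurable X]setTI.
  by apply: measurable_pts => //; exact: measurable_cell_preimage.
by apply/seteqP; split => [v Bv|v [m /= Bm ->]]//; exists (cell (pts i v)).
Qed.

Let prod01 (I : Type) (r : seq I) (F : I -> R) :
  (forall i, 0 <= F i <= 1)%R -> (0 <= \prod_(i <- r) F i <= 1)%R.
Proof.
move=> F01; apply/andP; split.
  by apply: prodr_ge0 => i _; have /andP[] := F01 i.
by apply: prodr_ile1 => i _.
Qed.

(** Since g is 1 on the cell of infinite mass, almost surely only finitely many
    factors differ from 1. Grouped by slabs the product is that of the g(k)^N_k, where the N_k are independent Poisson variables with mean e;
    each contributes its generating function exp(- e (1 - g k)). *)
Lemma cell_product_cvg :
  \int[Q]_v (\prod_(0 <= i < N) g (cell (pts i v)))%:E @[N --> \oo] -->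
  \prod_(0 <= k < K) (expR (- (e * (1 - g k))))%:E.
Proof.
pose lim v : R := (\prod_(0 <= k < K) g k ^+ occupation k v)%R.
have a01 k m : (0 <= g k ^+ m <= 1)%R.
  by have /andP[g0 g1] := g01 k; rewrite exprn_ge0//= exprn_ile1.
have cvg_lim : {ae Q, forall v, setT v ->
    (\prod_(0 <= i < N) g (cell (pts i v)))%:E @[N --> \oo] --> (lim v)%:E}.
  have : \forall v \ae Q, forall k, ~ non_nat (slab_count k v).
    apply: ae_foralln => k; exists (slab_count k @^-1` non_nat).
    by split; [exact: measurable_non_nat_count|exact: slab_count_nat|move=> v /= /contrapT].
  apply: filterS => v nv _.
    apply: cvg_near_cst.
    have : \forall N \near \oo, forall k : 'I_K,
        partial_count k N v = occupation k v.
      by apply: filter_forall => k; apply: partial_count_cvg.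
    apply: filterS => N kN; congr EFin; rewrite prod_cells /lim !big_mkord.
    by apply: eq_bigr => k _; rewrite kN.
have [|||_ _] := @dominated_convergence _ _ _ Q setT measurableT _
   (fun v => (lim v)%:E) (cst 1) measurable_prod_cells _ cvg_lim _ _.
- apply/measurable_EFinP; apply: measurable_prod => k _ _ B _; rewrite setTI.
  rewrite (_ : _ @^-1` _ =
    \bigcup_(m in [set m | B (g k ^+ m)%R]) (occupation k @^-1` [set m])).
    by apply: bigcup_measurable => m _; exact: measurable_occupation.
  by apply/seteqP; split => [v Bv|v [m /= Bm ->]]//; exists (occupation k v).
- by apply: finite_measure_integrable_cst.
- apply: aeW => v N _ /=; rewrite lee_fin ger0_norm.
    by have /andP[] := prod01 (index_iota 0 N) (fun i => g01 (cell (pts i v))).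
  by have /andP[] := prod01 (index_iota 0 N) (fun i => g01 (cell (pts i v))).
have -> : \int[Q]_v (lim v)%:E = \prod_(0 <= k < K) (expR (- (e * (1 - g k))))%:E.
  rewrite (integral_independent_prod measurable_occupation a01 occupation_independent).
  apply: eq_bigr => k _.
  rewrite (integral_level_sets _ measurable_occupation a01).
  rewrite -poisson_generating_function//; last by have /andP[] := g01 k.
  by apply: eq_eseriesr => m _; rewrite occupation_law.
by [].
Qed.

End limit.
End cell_product.

(** * Independent marks on the points *)
Lemma sigma_family_measurable d (W : measurableType d) d' (V : measurableType d')
    (K : Type) (D : set K) (X : K -> W -> V) :
  (forall k, D k -> measurable_fun setT (X k)) ->
  sigma_family D X `<=` measurable.
Proof.
move=> mX; apply: smallest_sub; first exact: sigma_algebra_measurable.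
by move=> _ [k Dk [B mB <-]]; exact: mX.
Qed.

Lemma sigma_family_preimage d (W : measurableType d) d' (V : measurableType d')
    (K : Type) (D : set K) (X : K -> W -> V) k B : D k -> measurable B ->
  sigma_family D X (X k @^-1` B).
Proof.
move=> Dk mB; apply: sub_sigma_algebra; exists k => //.
by exists B => //; rewrite setTI.
Qed.

Lemma sigma_familyI d (W : measurableType d) d' (V : measurableType d')
    (K : Type) (D : set K) (X : K -> W -> V) : setI_closed (sigma_family D X).
Proof. by move=> A B sA sB; exact: (@measurableI _ (g_sigma_algebraType _)). Qed.

(** The points are classified by the countably valued map cl, and the mark F i of
    the i-th point must stay below a level x(cl(p_i)) depending on the class of
    that point. *)
Section independent_marks.
Context d (V : measurableType d) (R : realType) (Q : probability V R).
Variables (pts : nat -> V -> R) (F : nat -> V -> \bar R) (G : \bar R -> R).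
Variables (cl : R -> nat) (x : nat -> \bar R).
Hypothesis mpts : forall i, measurable_fun setT (pts i).
Hypothesis mF : forall i, measurable_fun setT (F i).
Hypothesis mcl : forall m, measurable (cl @^-1` [set m]).
Hypothesis G0 : forall y, (0 <= G y)%R.
Hypothesis marks_indep : forall N A (y : nat -> \bar R), sigma_family setT pts A ->
  Q (A `&` \bigcap_(i in [set i | (i < N)%N]) [set v | F i v < y i]) =
  Q A * (\prod_(0 <= i < N) G (y i))%:E.

Definition marks_below N : set V :=
  \bigcap_(i in [set i | (i < N)%N]) [set v | F i v < x (cl (pts i v))].

Let cell_set i m : set V := pts i @^-1` (cl @^-1` [set m]).

Let sigma_cell_set i m : sigma_family setT pts (cell_set i m).
Proof. exact: sigma_family_preimage. Qed.

Let sigma_measurable A : sigma_family setT pts A -> measurable A.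
Proof. by apply: sigma_family_measurable => i _; exact: mpts. Qed.

Let measurable_cell_set i m : measurable (cell_set i m).
Proof. exact: sigma_measurable (sigma_cell_set i m). Qed.

Let measurable_F i y : measurable [set v | F i v < y].
Proof. by rewrite -[X in measurable X]setTI; exact: emeasurable_fun_infty_o. Qed.

Lemma measurable_marks_below N : measurable (marks_below N).
Proof.
apply: bigcap_measurableType => i _.
rewrite (_ : [set v | _] = \bigcup_m (cell_set i m `&` [set v | F i v < x m])).
  by apply: bigcupT_measurable => m; exact: measurableI.
by apply/seteqP; split => [v Fv|v [m _ [/= <-]]]//; exists (cl (pts i v)).
Qed.

Let prod_marks N v : R := (\prod_(0 <= i < N) G (x (cl (pts i v))))%R.

Let prod_marks_ge0 N v : (0 <= prod_marks N v)%R.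
Proof. by apply: prodr_ge0 => i _. Qed.

Let measurable_prod_marks N : measurable_fun setT (prod_marks N).
Proof.
apply: measurable_prod => i _ _ B _; rewrite setTI.
rewrite (_ : _ @^-1` _ = \bigcup_(m in [set m | B (G (x m))]) cell_set i m).
  by apply: bigcup_measurable => m _.
by apply/seteqP; split => [v Bv|v [m /= Bm ->]]//; exists (cl (pts i v)).
Qed.

Let future N M (y : nat -> \bar R) : set V :=
  \bigcap_(i in [set i | (N <= i < N + M)%N]) [set v | F i v < y i].

(** Given the points, the marks are independent and below y with probability G y. The
   induction on N processes one mark at a time: the mark N is taken out of the
   future by splitting according to the class m of the point N, on which the
   random level is the constant x m. *)
Let future_marks N M A y : sigma_family setT pts A ->
  Q (A `&` marks_below N `&` future N M y) =
  \int[Q]_(v in A) (prod_marks N v)%:E * (\prod_(N <= i < N + M) G (y i))%:E.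
Proof.
elim: N M A y => [|N ih] M A y sA.
  rewrite (_ : marks_below 0 = setT) ?setIT; last first.
    by apply/seteqP; split => // v _ i.
  rewrite add0n marks_indep//; congr (_ * _).
  under eq_integral do rewrite /prod_marks big_nil.
  by rewrite integral_cst ?mul1e//; exact: sigma_measurable.
pose C := (\prod_(N.+1 <= i < N.+1 + M) G (y i))%R.
pose y' m i := if i == N then x m else y i.
have mA := sigma_measurable sA.
have splitN : A `&` marks_below N.+1 `&` future N.+1 M y = \bigcup_m
   ((A `&` cell_set N m) `&` marks_below N `&` future N M.+1 (y' m)).
  apply/seteqP; split => v.
    move=> [[Av mv] fv]; exists (cl (pts N v)) => //; split; first split=> //.
      by move=> i /= iN; apply: mv; exact: ltnW.
    move=> i /= /andP[Ni iM]; rewrite /y'; case: eqP => [->|/eqP iN].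
      by apply: mv => /=.
    by apply: fv; rewrite /= addSnnS iM andbT ltn_neqAle eq_sym iN.
  move=> [m _ [[[Av /= vm] mv] fv]]; split; first split => //.
    move=> i /=; rewrite ltnS leq_eqVlt => /predU1P[->|]; last exact: mv.
    have := fv N; rewrite /y' eqxx/= leqnn addnS ltnS leq_addr => /(_ isT).
    by rewrite vm.
  move=> i /= /andP[Ni iM]; have := fv i; rewrite /= /y' gtn_eqF//.
  by apply; rewrite (ltnW Ni) -addSnnS.
rewrite splitN measure_bigcup//; last 2 first.
- move=> m _; apply: measurableI; first apply: measurableI.
  + exact: measurableI.
  + exact: measurable_marks_below.
  + by apply: bigcap_measurableType => i _; exact: measurable_F.
- by move=> m m' _ _ [v [[[[_ /= <-] _] _] [[[_ /= <-] _] _]]].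
rewrite (@eq_eseriesl _ _ xpredT); last by move=> m; rewrite in_setT.
have sAc m : sigma_family setT pts (A `&` cell_set N m) by exact: sigma_familyI.
transitivity (\sum_(m <oo) C%:E * \int[Q]_(v in A `&` cell_set N m) (prod_marks N.+1 v)%:E).
  apply: eq_eseriesr => m _.
  rewrite [LHS](ih M.+1 (A `&` cell_set N m) (y' m))//.
  have -> : (\prod_(N <= i < N + M.+1) G (y' m i) = G (x m) * C)%R.
    rewrite addnS big_ltn ?ltnS ?leq_addr//.
    rewrite /y' eqxx /C addSn; congr (_ * _)%R.
    by apply: eq_big_nat => i /andP[Ni _]; rewrite gtn_eqF.
  rewrite EFinM muleA [RHS]muleC; congr (_ * _).
  have mpN B : measurable_fun B (fun v => (prod_marks N v)%:E).
    by apply/measurable_EFinP; exact: measurable_funTS.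
  rewrite muleC -ge0_integralZl ?lee_fin//; first last.
    by move=> v _; rewrite lee_fin.
    exact: measurableI.
  apply: eq_integral => v /set_mem[_ /= vm].
  by rewrite -EFinM /prod_marks big_nat_recr//= vm mulrC.
rewrite nneseriesZl; last by move=> m _; apply: integral_ge0 => v _; rewrite lee_fin.
rewrite muleC -ge0_integral_bigcup//.
- congr (_ * _); congr (integral _ _ _).
  by apply/seteqP; split => [v [m _ []]//|v Av]; exists (cl (pts N v)).
- by move=> m; exact: measurableI.
- by apply/measurable_EFinP; exact: measurable_funTS.
- by move=> v _; rewrite lee_fin.
- by move=> m m' _ _ [v [[_ /= <-] [_ <-]]].
Qed.

Lemma marks_below_prob N :
  Q (marks_below N) = \int[Q]_v (\prod_(0 <= i < N) G (x (cl (pts i v))))%:E.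
Proof.
have := @future_marks N 0 setT x (@measurableT _ (g_sigma_algebraType _)).
rewrite addn0 big_geq// mule1 setTI (_ : future _ _ _ = setT) ?setIT//.
apply/seteqP; split => // v _ i /=; rewrite addn0 => /andP[Ni].
by rewrite ltnNge Ni.
Qed.

End independent_marks.

(** * Staircase approximation *)

(** The function min(e floor(r / e), e K), as a sum of steps whose expectations are
    tail probabilities. *)
Section staircase.
Context (R : realType).
Implicit Types (e r : R) (K : nat).

Definition staircase e K r : R :=
  (\sum_(0 <= k < K) e * (k.+1%:R * e <= r)%R%:R)%R.

Lemma staircaseE e K r : (0 < e)%R -> (0 <= r)%R ->
  staircase e K r = (e * (minn K (Num.truncn (r / e)))%:R)%R.
Proof.
move=> e0 r0; rewrite /staircase -mulr_sumr -natr_sum; congr (_ * _%:R)%R.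
have re0 : (0 <= r / e)%R by rewrite divr_ge0// ltW.
under eq_bigr do rewrite -ler_pdivlMr// -truncn_ge_nat//.
elim: K => [|K ih]; first by rewrite big_geq// min0n.
rewrite big_nat_recr//= ih; case: ltnP => Kt.
  by rewrite (minn_idPl Kt) addn1.
by rewrite (minn_idPr (leqW Kt)) addn0.
Qed.

Lemma staircase_ge0 e K r : (0 < e)%R -> (0 <= staircase e K r)%R.
Proof. by move=> e0; apply: sumr_ge0 => k _; rewrite mulr_ge0// ltW. Qed.

Lemma staircase_le e K r : (0 < e)%R -> (0 <= r)%R -> (staircase e K r <= r)%R.
Proof.
move=> e0 r0; rewrite staircaseE// mulrC -ler_pdivlMr//.
have re0 : (0 <= r / e)%R by rewrite divr_ge0// ltW.
by rewrite (@le_trans _ _ (Num.truncn (r / e))%:R)%R// ?ler_nat ?geq_minr// truncn_le.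
Qed.

(** The top of the staircase is mesh n * height n = n + 1, so that the mesh
    shrinks while every r is eventually below the top. *)
Definition mesh n : R := n.+1%:R^-1%R.
Definition height n : nat := (n.+1 ^ 2)%N.

Lemma mesh_gt0 n : (0 < mesh n)%R.
Proof. by rewrite invr_gt0 ltr0n. Qed.

Lemma mesh_cvg0 : mesh n @[n --> \oo] --> (0 : R)%R.
Proof. exact: cvg_harmonic. Qed.

Lemma near_truncn_lt_height r : (0 <= r)%R ->
  \forall n \near \oo, (Num.truncn (r / mesh n) < height n)%N.
Proof.
move=> r0; near=> n.
rewrite truncn_lt_nat; last by rewrite divr_ge0// ltW// mesh_gt0.
rewrite /mesh invrK /height expnS expn1 natrM ltr_pM2r ?ltr0n//.
rewrite (@le_lt_trans _ _ n%:R)%R ?ltr_nat//.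
by near: n; exact: nbhs_infty_ger.
Unshelve. all: by end_near. Qed.

Lemma staircase_cvg r : (0 <= r)%R ->
  staircase (mesh n) (height n) r @[n --> \oo] --> r.
Proof.
move=> r0; apply: (@squeeze_cvgr _ _ _ _ (fun n => r - mesh n)%R (cst r)); last 2 first.
- by rewrite -[X in _ --> X]subr0; apply: cvgB; [exact: cvg_cst|exact: mesh_cvg0].
- exact: cvg_cst.
near=> n; rewrite staircase_le ?mesh_gt0// andbT.
have tn : (Num.truncn (r / mesh n) < height n)%N.
  by near: n; exact: near_truncn_lt_height.
rewrite staircaseE ?mesh_gt0// (minn_idPr (ltnW tn)) lerBlDr.
have re0 : (0 <= r / mesh n)%R by rewrite divr_ge0// ltW// mesh_gt0.
have /andP[_ /ltW] := truncn_itv re0.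
by rewrite ler_pdivrMr ?mesh_gt0// -natr1 mulrDl mul1r [X in (_ <= X + _)%R]mulrC.
Unshelve. all: by end_near. Qed.

End staircase.

(** * Void probabilities of the marked Poisson process *)
Section void_probability.
Context d (V : measurableType d) (R : realType) (Q : probability V R).
Variables (pts : nat -> V -> R) (F : nat -> V -> \bar R).
Context d' (W : measurableType d') (P : probability W R) (f : W -> R).
Hypothesis ppp : gumbel_poisson_process Q pts.
Hypothesis mF : forall i, measurable_fun setT (F i).
Hypothesis Foo : forall i v, F i v < +oo.
Hypothesis F0 : forall i v, 0 <= F i v.
Hypothesis f0 : forall w, (0 <= f w)%R.
Hypothesis intf : P.-integrable setT (EFin \o f).

Let G (y : \bar R) : R := fine (P [set w | (f w)%:E < y]).

Hypothesis marks_indep : forall N A (y : nat -> \bar R), sigma_family setT pts A ->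
  Q (A `&` \bigcap_(i in [set i | (i < N)%N]) [set v | F i v < y i]) =
  Q A * (\prod_(0 <= i < N) fine (P [set w | ((f w)%:E < y i)%E]))%:E.

Let mpts i : measurable_fun setT (pts i).
Proof. by case: ppp. Qed.

Let mf : measurable_fun setT f.
Proof. exact/measurable_EFinP/(measurable_int _ intf). Qed.

Let measurable_f_lt y : measurable [set w | (f w)%:E < y].
Proof.
rewrite -[X in measurable X]setTI; apply: emeasurable_fun_infty_o => //.
exact/measurable_EFinP.
Qed.

Let G0 y : (0 <= G y)%R. Proof. exact: fine_ge0. Qed.

Let G1 y : (G y <= 1)%R.
Proof.
rewrite -lee_fin fineK ?fin_num_measure//; exact: probability_le1.
Qed.

(** A point in the slab k has e^(-p) between k e and (k+1) e. Its mark is compared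
   with the upper end of the slab, so that the discretized event contains the
   exact one. No condition is imposed on the points beyond the K-th slab. *)
Let threshold e K k : \bar R := if (k < K)%N then (k.+1%:R * e)%:E else +oo.

Let all_marks_below e K : set V :=
  \bigcap_i [set v | F i v < threshold e K (cell e K (pts i v))].

Let integral_staircase e K : (0 < e)%R ->
  \int[P]_w (staircase e K (f w))%:E =
  (\sum_(0 <= k < K) e * (1 - G (threshold e K k)))%:E.
Proof.
move=> e0.
have mge k : measurable [set w | (k.+1%:R * e <= f w)%R].
  by rewrite -[X in measurable X]setTI; exact: measurable_fun_le.
transitivity (\int[P]_w \sum_(0 <= k < K) e%:E * (\1_[set w | (k.+1%:R * e <= f w)%R] w)%:E).
  apply: eq_integral => w _; rewrite /staircase -sumEFin; apply: eq_bigr => k _.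
  by rewrite EFinM indicE mem_setE.
rewrite ge0_integral_sum//; last 2 first.
- by move=> k; apply: measurable_funeM; apply/measurable_EFinP/measurable_indic.
- by move=> k w _; rewrite mule_ge0 ?lee_fin// ltW.
rewrite -sumEFin !big_nat; apply: eq_bigr => k /andP[_ kK].
rewrite ge0_integralZl ?lee_fin ?(ltW e0)//; last first.
  by apply/measurable_EFinP/measurable_indic.
rewrite integral_indic// setIT EFinM; congr (_ * _).
rewrite /threshold kK EFinB /G fineK ?fin_num_measure//.
rewrite -probability_setC//; congr (P _); apply/seteqP; split => w /=.
  by rewrite lte_fin => kw; apply/negP; rewrite -leNgt.
by rewrite lte_fin => /negP; rewrite -leNgt.
Qed.

(** The product of the factors exp(- e (1 - G((k+1) e))) over the slabs, in which
   the exponents add up to the expected staircase. *)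
Let all_marks_below_prob e K : (0 < e)%R ->
  Q (all_marks_below e K) = expeR (- \int[P]_w (staircase e K (f w))%:E).
Proof.
move=> e0; have mcell := measurable_cell_preimage K e0.
pose E := marks_below pts F (cell e K) (threshold e K).
have mE N : measurable (E N) by exact: measurable_marks_below.
have -> : all_marks_below e K = \bigcap_N E N.
  apply/seteqP; split => [v Fv N _ i _|v Fv i _]; first exact: Fv.
  by apply: (Fv i.+1) => //=.
have cvgE : Q (E N) @[N --> \oo] --> Q (\bigcap_N E N).
  apply: nonincreasing_cvg_mu => //.
  - by rewrite (le_lt_trans (probability_le1 _ _)) ?ltry.
  - exact: bigcapT_measurable.
  - move=> N M NM; apply/subsetPset => v Ev i /= iN; apply: Ev => /=.
    exact: leq_trans NM.
rewrite -(cvg_lim _ cvgE)//.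
have -> : (fun N => Q (E N)) = fun N =>
    \int[Q]_v (\prod_(0 <= i < N) G (threshold e K (cell e K (pts i v))))%:E.
  by apply/funext => N; exact: (marks_below_prob (G := G)).
pose g k := G (threshold e K k).
have g01 k : (0 <= g k <= 1)%R by rewrite /g G0 G1.
have gK : g K = 1%R.
  rewrite /g /threshold ltnn /G (_ : [set w | _] = setT) ?probability_setT//.
  by apply/seteqP; split => // w _; rewrite /= ltry.
have := cell_product_cvg e0 ppp g01 gK => /cvg_lim ->//.
rewrite integral_staircase//= -sumrN expR_sum.
by rewrite -prodEFin; apply: eq_bigr.
Qed.

Let no_exceedance : set V :=
  \bigcap_i [set v | F i v <= (expR (- pts i v))%:E].

Let measurable_no_exceedance : measurable no_exceedance.
Proof.
apply: bigcapT_measurable => i; rewrite -[X in measurable X]setTI.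
apply: measurable_lee => //.
by apply/measurable_EFinP; do 2 apply: measurableT_comp => //.
Qed.

Let measurable_all_marks_below e K : (0 < e)%R -> measurable (all_marks_below e K).
Proof.
move=> e0; have mcell := measurable_cell_preimage K e0.
rewrite (_ : all_marks_below e K =
    \bigcap_N marks_below pts F (cell e K) (threshold e K) N).
  by apply: bigcapT_measurable => N; exact: measurable_marks_below.
apply/seteqP; split => [v Fv N _ i _|v Fv i _]; first exact: Fv.
by apply: (Fv i.+1) => //=.
Qed.

Let no_exceedance_sub e K : (0 < e)%R -> no_exceedance `<=` all_marks_below e K.
Proof.
move=> e0 v Fv i _; rewrite /= /threshold; case: ifPn => [cK|_]; last exact: Foo.
have /andP[_ pc] : slab e (cell e K (pts i v)) (pts i v).
  exact/(cell_slab e0 (pts i v) cK).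
by apply: (le_lt_trans (Fv i Logic.I)); rewrite lte_fin; exact: pc.
Qed.

(** If the mark of some point exceeds e^(-p), then by more than the mesh for large
   n, and it exceeds the upper end of the slab of p as well. *)
Let exceedance_seen v : ~ no_exceedance v ->
  \forall n \near \oo, ~ all_marks_below (mesh R n) (height n) v.
Proof.
move=> /existsNP[i /not_implyP[_ /negP]]; rewrite -ltNge.
have : F i v \is a fin_num by rewrite ge0_fin_numE.
move=> /fineK <-; set r := fine _; set u := expR _; rewrite lte_fin => ur.
near=> n => /(_ i Logic.I) /=.
have tn : (Num.truncn (u / mesh R n) < height n)%N.
  by near: n; apply: near_truncn_lt_height; exact: expR_ge0.
rewrite /cell (minn_idPr (ltnW tn)) /threshold tn -[F i v]fineK ?ge0_fin_numE//.
rewrite lte_fin -/r; apply/negP; rewrite -leNgt.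
have ue0 : (0 <= u / mesh R n)%R by rewrite divr_ge0 ?expR_ge0// ltW// mesh_gt0.
have : ((Num.truncn (u / mesh R n))%:R * mesh R n <= u)%R.
  by rewrite -ler_pdivlMr ?mesh_gt0// truncn_le.
have : (mesh R n < r - u)%R.
  near: n; have := @mesh_cvg0 R => /cvgrPdist_lt /(_ (r - u)%R).
  rewrite subr_gt0 => /(_ ur); apply: filterS => n.
  by rewrite sub0r normrN gtr0_norm ?mesh_gt0.
rewrite -natr1 mulrDl mul1r ltrBrDl => uer tu.
apply/ltW/(le_lt_trans _ uer); by rewrite lerD2r.
Unshelve. all: by end_near. Qed.

Let all_marks_below_cvg :
  Q (all_marks_below (mesh R n) (height n)) @[n --> \oo] --> Q no_exceedance.
Proof.
have mE n := measurable_all_marks_below (height n) (mesh_gt0 R n).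
have QE A : measurable A -> Q A = \int[Q]_v (\1_A v)%:E.
  by move=> mA; rewrite integral_indic// setIT.
rewrite QE//; under eq_fun do rewrite QE//.
have [|||||_ _] := @dominated_convergence _ _ _ Q setT measurableT
  (fun n v => (\1_(all_marks_below (mesh R n) (height n)) v)%:E)
  (fun v => (\1_no_exceedance v)%:E) (cst 1).
- by move=> n; exact/measurable_EFinP/measurable_indic.
- exact/measurable_EFinP/measurable_indic.
- apply: aeW => v _; apply: cvg_near_cst.
  have [vE|vE] := pselect (no_exceedance v).
    near=> n; rewrite !indicE !mem_set//.
    exact: no_exceedance_sub (mesh_gt0 R n) v vE.
  near=> n; rewrite !indicE !memNset//.
  by near: n; exact: exceedance_seen.
- exact: finite_measure_integrable_cst.
- by apply: aeW => v n _ /=; rewrite lee_fin ger0_norm// indicE; case: (_ \in _).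
by [].
Unshelve. all: by end_near. Qed.

Let integral_staircase_cvg :
  \int[P]_w (staircase (mesh R n) (height n) (f w))%:E @[n --> \oo] -->
  \int[P]_w (f w)%:E.
Proof.
have [||||_ _] := @dominated_convergence _ _ _ P setT measurableT
  (fun n w => (staircase (mesh R n) (height n) (f w))%:E)
  (fun w => (f w)%:E) (EFin \o f) _ _ _ intf.
- move=> n; apply/measurable_EFinP; apply: measurable_sum => k.
  apply: measurable_funM => //.
  rewrite (_ : (fun w => _) = \1_[set w | (k.+1%:R * mesh R n <= f w)%R]).
    apply: measurable_indic.
    by rewrite -[X in measurable X]setTI; exact: measurable_fun_le.
  by apply/funext => w; rewrite indicE mem_setE.
- exact/measurable_EFinP.
- apply: aeW => w _; apply/cvg_EFin; first exact: nearW.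
  exact: staircase_cvg.
- apply: aeW => w n _ /=; rewrite lee_fin ger0_norm ?staircase_ge0 ?mesh_gt0//.
  by rewrite staircase_le ?mesh_gt0.
by [].
Qed.

(** No mark F_i exceeds e^(-p_i) with probability exp(- E f), where f has the
    common law of the marks. In the variable u = e^(-p) the expected number of
    exceedances is the integral of P(f > u) over u > 0, which is E f; the formula
    is first obtained for marks compared with the slabs of e^(-p), and passes to
    the limit as the slabs get thin. *)
Theorem poisson_void_probability :
  Q (\bigcap_i [set v | F i v <= (expR (- pts i v))%:E]) =
  expeR (- \int[P]_w (f w)%:E).
Proof.
rewrite -(cvg_lim _ all_marks_below_cvg)//.
have -> : (fun n => Q (all_marks_below (mesh R n) (height n))) = fun n =>
    (expR (- fine (\int[P]_w (staircase (mesh R n) (height n) (f w))%:E)))%:E.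
  apply/funext => n; rewrite all_marks_below_prob ?mesh_gt0//.
  by rewrite integral_staircase ?mesh_gt0.
have /fineK <- : \int[P]_w (f w)%:E \is a fin_num.
  exact: integrable_fin_num.
apply/cvg_lim => //; apply/cvg_EFin; first exact: nearW.
apply: continuous_cvg; first exact: continuous_expR.
apply: cvgN; apply: fine_cvg; rewrite fineK; first exact: integral_staircase_cvg.
exact: integrable_fin_num.
Qed.

End void_probability.

(** * Max-stable processes and their exponents *)
Lemma scaled_expeR_sup (R : realType) (c : R) (A : set (\bar R)) : (0 <= c)%R ->
  c%:E * expeR (ereal_sup A) <= 1 <-> (forall x, A x -> c%:E * expeR x <= 1).
Proof.
rewrite le_eqVlt => /predU1P[<-|c0]; first by split => [_ x _|_]; rewrite mul0e.
have [y yc] : exists y : \bar R, expeR y = (c^-1)%:E.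
  by apply: expeR_total; rewrite lee_fin invr_ge0 ltW.
have cE x : (c%:E * expeR x <= 1) = (x <= y).
  by rewrite -[RHS]lee_expeR yc -[X in _ = (_ <= X)]mul1e lee_pdivlMr// muleC.
rewrite cE; split => [Ay x Ax|Ay]; first by rewrite cE (le_trans _ Ay)//; exact: ereal_sup_ubound.
by apply: ge_ereal_sup => x Ax; rewrite -cE; exact: Ay.
Qed.

Lemma scaled_expeR_shift (R : realType) (c p : R) (x : \bar R) :
  (c%:E * expeR (p%:E + x) <= 1) = (c%:E * expeR x <= (expR (- p))%:E).
Proof.
rewrite expRN -[X in _ = (_ <= X)]mul1e lee_pdivlMr ?expR_gt0//.
by rewrite expeRD -muleA [expeR x * _]muleC.
Qed.

Section max_stable_box.
Context d (W : measurableType d) (R : realType) (I : set R) (P : probability W R).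
Variable Z : R -> W -> \bar R.
Context d' (V : measurableType d') (Q : probability V R) (zeta : R -> V -> \bar R).
Hypothesis Z_process : process I Z.
Hypothesis zeta_assoc : max_stable_process I P Z Q zeta.

(** For the marks F_i = max_j c_j e^(Z_i(t_j)), the box event for zeta says that no
    mark exceeds e^(-p_i). *)
Lemma max_stable_box_prob n (t : n.-tuple R) (c : 'I_n -> R) :
  (forall i, (0 <= c i)%R) -> (forall s, s \in t -> I s) ->
  (forall s, I s -> \int[P]_w expeR (Z s w) < +oo) ->
  Q [set v | exp_box c (map_tuple (zeta ^~ v) t)] =
  expeR (- \int[P]_w weighted_max c (map_tuple (Z ^~ w) t)).
Proof.
move=> c0 tI intZ; case: zeta_assoc => pts [Zc [ppp Zc_law Zc_indep zetaE]].
case: Z_process => mZ Zoo.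
have It i : I (tnth t i) by exact/tI/mem_tnth.
pose F i v := weighted_max c (map_tuple (Zc i ^~ v) t).
pose f w := fine (weighted_max c (map_tuple (Z ^~ w) t)).
have mZt : measurable_fun setT (fun w => map_tuple (Z ^~ w) t).
  by apply: measurable_map_tuple => s /tI; exact: mZ.
have fE w : (f w)%:E = weighted_max c (map_tuple (Z ^~ w) t).
  rewrite fineK// ge0_fin_numE ?weighted_max_ge0// weighted_max_lty// => i.
  by rewrite tnth_map; exact: Zoo.
have mf : measurable_fun setT (EFin \o f).
  rewrite (_ : _ \o _ = fun w => weighted_max c (map_tuple (Z ^~ w) t)).
    exact: measurableT_comp (@measurable_weighted_max _ _ c) mZt.
  by apply/funext => w /=; rewrite fE.
have intf : P.-integrable setT (EFin \o f).
  apply/integrableP; split => //.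
  rewrite (eq_integral (fun w => weighted_max c (map_tuple (Z ^~ w) t))).
    apply: integral_weighted_max_lty => // i.
    by under eq_integral do rewrite tnth_map; exact: intZ.
  by move=> w _; rewrite /= ger0_norm ?fE// fine_ge0// weighted_max_ge0.
have mZct i : measurable_fun setT (fun v => map_tuple (Zc i ^~ v) t).
  by case: (Zc_law i) => -[mZc _] _; apply: measurable_map_tuple => s /tI; exact: mZc.
have mF i : measurable_fun setT (F i).
  exact: measurableT_comp (@measurable_weighted_max _ _ c) (mZct i).
have mlt y : measurable [set x : n.-tuple (\bar R) | weighted_max c x < y].
  rewrite -[X in measurable X]setTI; apply: emeasurable_fun_infty_o => //.
  exact: measurable_weighted_max.
have -> : \int[P]_w weighted_max c (map_tuple (Z ^~ w) t) = \int[P]_w (f w)%:E.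
  by apply: eq_integral => w _; rewrite fE.
rewrite -(@poisson_void_probability _ _ _ Q pts F _ _ P f ppp mF _ _ _ intf); first last.
- move=> N A y sA.
  have F_law i : Q [set v | F i v < y i] = (fine (P [set w | ((f w)%:E < y i)%E]))%:E.
    rewrite fineK; last first.
      rewrite fin_num_measure// -[X in measurable X]setTI.
      exact: emeasurable_fun_infty_o.
    have := (Zc_law i).2 n t _ tI (mlt (y i)); rewrite /marginal /law /= => ->.
    by congr (P _); apply/seteqP; split => w; rewrite /= fE.
  (* Mutual independence, with A as the event on the points and the finitely many
     events F i < y i on the copies. *)
  pose E (o : option nat) := if o is Some i then [set v | F i v < y i] else A.
  pose s : seq (option nat) := None :: map Some (iota 0 N).
  pose J := [fset o in s]%fset.
  have sJ : perm_eq J s.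
    apply: uniq_perm; first exact: fset_uniq.
      rewrite /= map_inj_uniq ?iota_uniq ?andbT; last by move=> ? ? [].
      by apply/mapP => -[].
    by move=> o; rewrite in_fset.
  have EJ : forall k, k \in J -> (if k is Some i then sigma_family I (Zc i)
      else sigma_family setT pts) (E k).
    move=> [i|] _ //=.
    pose T' := g_sigma_algebraType (\bigcup_(k in I) g_sigma_algebra_preimage (Zc i k)).
    have mZ' : measurable_fun setT ((fun v => map_tuple (Zc i ^~ v) t) : T' -> _).
      apply: (@measurable_map_tuple _ T') => r /tI Ir _ B mB; rewrite setTI.
      exact: sigma_family_preimage.
    by have := mZ' measurableT _ (mlt (y i)); rewrite setTI.
  have := Zc_indep J E EJ; rewrite (perm_big _ sJ)/= big_cons big_map /=.
  rewrite /index_iota subn0 -prodEFin; under [X in _ = _ * X -> _]eq_bigr do rewrite F_law.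
  move=> <-; congr (Q _); apply/seteqP; split => v.
    move=> [Av Fv] o /=; rewrite in_fset inE => /predU1P[->//|/mapP[i]].
    by rewrite mem_iota add0n => /andP[_ iN] ->; exact: Fv.
  move=> Ev; split; first by apply: (Ev None); rewrite /= in_fset inE.
  move=> i /= iN; apply: (Ev (Some i)); rewrite /= in_fset inE map_f ?orbT//.
  by rewrite mem_iota.
- by move=> w; rewrite fine_ge0// weighted_max_ge0.
- by move=> i v; exact: weighted_max_ge0.
- move=> i v; apply: weighted_max_lty => j; rewrite tnth_map.
  by case: (Zc_law i) => -[_ Zcoo] _; exact: Zcoo.
congr (Q _); apply/seteqP; split => v.
  move=> zv i _; apply/weighted_max_le; first by rewrite lee_fin expR_ge0.
  move=> j; have := zv j; rewrite !tnth_map zetaE//.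
  move=> /(scaled_expeR_sup _ (c0 j)) /(_ ((pts i v)%:E + Zc i (tnth t j) v)).
  by rewrite scaled_expeR_shift; apply; exists i.
move=> Fv j; rewrite tnth_map zetaE//; apply/(scaled_expeR_sup _ (c0 j)).
move=> _ [i _ <-]; have /weighted_max_le := Fv i Logic.I.
rewrite lee_fin expR_ge0 => /(_ isT)/(_ j); rewrite tnth_map.
by rewrite scaled_expeR_shift.
Qed.

End max_stable_box.

Definition max_exponent d (W : measurableType d) (R : realType)
    (P : probability W R) (Z : R -> W -> \bar R) n (t : n.-tuple R)
    (c : 'I_n -> R) : \bar R :=
  \int[P]_w weighted_max c (map_tuple (Z ^~ w) t).

Definition shift_tuple (R : realType) (h : R) n (t : n.-tuple R) : n.-tuple R :=
  map_tuple (fun s => s + h)%R t.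

Lemma map_shift_tuple (R : realType) T (X : R -> T) h n (t : n.-tuple R) :
  map_tuple (fun s => X (s + h)%R) t = map_tuple X (shift_tuple h t).
Proof. by apply: val_inj; rewrite /= -map_comp. Qed.

Lemma shift_tupleD (R : realType) (h k : R) n (t : n.-tuple R) :
  shift_tuple k (shift_tuple h t) = shift_tuple (h + k)%R t.
Proof.
by apply: val_inj; rewrite /= -map_comp; apply: eq_map => s /=; rewrite addrA.
Qed.

Lemma shift_tuple0 (R : realType) n (t : n.-tuple R) : shift_tuple 0%R t = t.
Proof.
by apply: val_inj; rewrite /= -[RHS]map_id; apply: eq_map => s; rewrite addr0.
Qed.

Section max_stable_marginals.
Context (R : realType).

Lemma measurable_max_stable d (W : measurableType d) (I : set R)
    (P : probability W R) (Z : R -> W -> \bar R)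
    d' (V : measurableType d') (Q : probability V R) (zeta : R -> V -> \bar R) :
  max_stable_process I P Z Q zeta ->
  forall s, I s -> measurable_fun setT (zeta s).
Proof.
move=> [pts [Zc [[mpts _ _ _] Zc_law _ zetaE]]] s Is.
rewrite (_ : zeta s = fun v => esups (fun i => (pts i v)%:E + Zc i s v) 0%N).
  apply: measurable_fun_esups => i; apply: emeasurable_funD.
    exact/measurable_EFinP.
  by case: (Zc_law i) => -[mZc _] _; exact: mZc.
apply/funext => v; rewrite zetaE// /esups; congr ereal_sup.
by apply/seteqP; split => x [i _ <-]; exists i.
Qed.

Lemma max_stable_marginal_eq
    d (W : measurableType d) (I : set R) (P : probability W R) (Z : R -> W -> \bar R)
    e (V : measurableType e) (Q : probability V R) (zeta : R -> V -> \bar R)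
    d' (W' : measurableType d') (I' : set R) (P' : probability W' R) (Z' : R -> W' -> \bar R)
    e' (V' : measurableType e') (Q' : probability V' R) (zeta' : R -> V' -> \bar R)
    n (t t' : n.-tuple R) :
  process I Z -> max_stable_process I P Z Q zeta ->
  process I' Z' -> max_stable_process I' P' Z' Q' zeta' ->
  (forall s, I s -> \int[P]_w expeR (Z s w) = 1) ->
  (forall s, I' s -> \int[P']_w expeR (Z' s w) = 1) ->
  (forall s, s \in t -> I s) -> (forall s, s \in t' -> I' s) ->
  (forall c, (forall i, (0 <= c i)%R) ->
    max_exponent P Z t c = max_exponent P' Z' t' c) ->
  forall B, measurable B ->
  Q [set v | B (map_tuple (zeta ^~ v) t)] = Q' [set v | B (map_tuple (zeta' ^~ v) t')].
Proof.
move=> pZ mZ pZ' mZ' intZ intZ' tI tI' eqL B mB.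
have mt : measurable_fun setT (fun v => map_tuple (zeta ^~ v) t).
  by apply: measurable_map_tuple => s /tI; exact: measurable_max_stable mZ s.
have mt' : measurable_fun setT (fun v => map_tuple (zeta' ^~ v) t').
  by apply: measurable_map_tuple => s /tI'; exact: measurable_max_stable mZ' s.
apply: (tuple_law_unique (m1 := image_law Q mt) (m2 := image_law Q' mt')) mB => c c0.
transitivity (Q [set v | exp_box c (map_tuple (zeta ^~ v) t)]) => //.
transitivity (Q' [set v | exp_box c (map_tuple (zeta' ^~ v) t')]) => //.
rewrite (max_stable_box_prob pZ mZ)//; last by move=> s Is; rewrite intZ// ltry.
rewrite (max_stable_box_prob pZ' mZ')//; last by move=> s Is; rewrite intZ'// ltry.
by congr (expeR (- _)); exact: eqL.
Qed.

Lemma stationary_max_exponent d (W : measurableType d) (P : probability W R)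
    (Z : R -> W -> \bar R) (I : set R)
    d' (V : measurableType d') (Q : probability V R) (zeta : R -> V -> \bar R) :
  process I Z -> (forall s, I s -> \int[P]_w expeR (Z s w) = 1) ->
  max_stable_process I P Z Q zeta -> stationary I Q zeta ->
  (forall s h, I s -> I h -> I (s + h)%R) ->
  forall h n (t : n.-tuple R) c, I h -> (forall s, s \in t -> I s) ->
    (forall i, (0 <= c i)%R) ->
    max_exponent P Z (shift_tuple h t) c = max_exponent P Z t c.
Proof.
move=> pZ intZ mZ statZ ID h n t c Ih tI c0.
have tI' s : s \in shift_tuple h t -> I s.
  by move=> /mapP[r /tI Ir ->]; exact: ID.
apply: oppe_inj; apply: expeR_inj.
rewrite -(max_stable_box_prob pZ mZ)//; last by move=> s Is; rewrite intZ// ltry.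
rewrite -(max_stable_box_prob pZ mZ)//; last by move=> s Is; rewrite intZ// ltry.
have := statZ h Ih n t _ tI (measurable_exp_box c).
rewrite /marginal /law /= => <-.
by congr (Q _); apply/funext => v /=; rewrite -map_shift_tuple.
Qed.

End max_stable_marginals.

(** * The two-sided process *)
Lemma tilt_eq_off_Ny d (W : measurableType d) (R : realType) (P : probability W R)
    (U : W -> \bar R) (mU : measurable_fun setT U)
    (intU : \int[P]_w expeR (U w) = 1) (A B : set W) :
  (forall w, -oo < U w -> A w <-> B w) -> tilt mU intU A = tilt mU intU B.
Proof.
move=> AB; rewrite /tilt !tiltedE integral_mkcond [RHS]integral_mkcond.
apply: eq_integral => w _; rewrite !patchE.
have [Uw|] := ltP -oo (U w).
  have -> : (w \in A) = (w \in B) by apply/idP/idP => /set_mem/(AB w Uw)/mem_set.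
  by [].
by rewrite leeNy_eq /= => /eqP ->; rewrite /= -[point]/(0 : \bar R) !if_same.
Qed.

Section two_sided.
Context (R : realType) d (W : measurableType d) (P : probability W R).
Variable Z : R -> W -> \bar R.
Hypothesis mZ : forall s, (0 <= s)%R -> measurable_fun setT (Z s).
Hypothesis Zoo : forall s w, (0 <= s)%R -> Z s w < +oo.
Hypothesis intZ : forall s, (0 <= s)%R -> \int[P]_w expeR (Z s w) = 1.
Hypothesis shiftZ : forall h n (t : n.-tuple R) c, (0 <= h)%R ->
  (forall s, s \in t -> 0 <= s)%R -> (forall i, (0 <= c i)%R) ->
  max_exponent P Z (shift_tuple h t) c = max_exponent P Z t c.

Definition Xi (h : R) (n : nat) (t : n.-tuple R) (w : W) : n.-tuple (\bar R) :=
  increments (Z h w) (map_tuple (Z ^~ w) (shift_tuple h t)).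

Let shift_ge0 (h : R) n (t : n.-tuple R) : (forall s, s \in t -> 0 <= s + h)%R ->
  forall s, (s \in shift_tuple h t -> 0 <= s)%R.
Proof. by move=> th s /mapP[r /th rh ->]. Qed.

Let measurable_Zt n (t : n.-tuple R) : (forall s, s \in t -> 0 <= s)%R ->
  measurable_fun setT (fun w => map_tuple (Z ^~ w) t).
Proof. by move=> t0; apply: measurable_map_tuple => s /t0; exact: mZ. Qed.

Definition tiltZ (h : R) (h0 : (0 <= h)%R) : probability W R :=
  tilt (mZ h0) (intZ h0).

Lemma measurable_Xi (h : R) n (t : n.-tuple R) : (0 <= h)%R ->
  (forall s, s \in t -> 0 <= s + h)%R -> measurable_fun setT (Xi h t).
Proof.
move=> h0 th; apply: measurable_increments; first exact: mZ.
exact/measurable_Zt/shift_ge0.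
Qed.

Let Xi_tilt_le (h k : R) (h0 : (0 <= h)%R) (k0 : (0 <= k)%R) n (t : n.-tuple R) B :
  (h <= k)%R -> (forall s, s \in t -> 0 <= s + h)%R -> measurable B ->
  tiltZ k0 [set w | B (Xi k t w)] = tiltZ h0 [set w | B (Xi h t w)].
Proof.
move=> hk th mB.
have tk s : s \in t -> (0 <= s + k)%R by move=> /th sh; rewrite (le_trans sh)// lerD2l.
have Zt_oo (l : R) : (forall s, s \in t -> 0 <= s + l)%R ->
    forall w i, tnth (map_tuple (Z ^~ w) (shift_tuple l t)) i < +oo.
  by move=> tl w i; rewrite !tnth_map; apply/Zoo/tl/mem_tnth.
have intZt (l : R) : (forall s, s \in t -> 0 <= s + l)%R ->
    forall i, \int[P]_w expeR (tnth (map_tuple (Z ^~ w) (shift_tuple l t)) i) < +oo.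
  move=> tl i; under eq_integral do rewrite !tnth_map.
  by rewrite intZ ?ltry//; apply/tl/mem_tnth.
apply: tilt_determined => //; try solve
  [exact: Zt_oo|exact: intZt|exact/measurable_Zt/shift_ge0|by move=> w; exact: Zoo].
move=> c0 c c00 c_ge0.
have consE (l : R) : \int[P]_w maxe (c0%:E * expeR (Z l w))
    (weighted_max c (map_tuple (Z ^~ w) (shift_tuple l t))) =
    max_exponent P Z [tuple of l :: shift_tuple l t] (cons_weight c0 c).
  apply: eq_integral => w _; rewrite -weighted_max_cons; congr weighted_max.
  exact: val_inj.
rewrite !consE -(@shiftZ (k - h)%R _ [tuple of h :: shift_tuple h t]).
- congr max_exponent; apply: val_inj => /=; rewrite addrC subrK -map_comp.
  by congr cons; apply: eq_map => s /=; rewrite addrA addrAC addrK [RHS]addrC; lra.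
- by rewrite subr_ge0.
- by move=> s; rewrite inE => /predU1P[->//|]; exact: shift_ge0.
- by move=> i; rewrite /cons_weight; case: unlift.
Qed.

(** The two tilted increments have the same expected maxima, since these are
    exponents of Z at times which differ by the shift k - h. *)
Lemma Xi_tilt (h k : R) (h0 : (0 <= h)%R) (k0 : (0 <= k)%R) n (t : n.-tuple R) B :
  (forall s, s \in t -> 0 <= s + h)%R -> (forall s, s \in t -> 0 <= s + k)%R ->
  measurable B ->
  tiltZ k0 [set w | B (Xi k t w)] = tiltZ h0 [set w | B (Xi h t w)].
Proof.
by move=> th tk mB; have [hk|/ltW kh] := leP h k; [|apply/esym]; exact: Xi_tilt_le.
Qed.

(** The value 0 at the times before -n is a filler: every time lies in [-n, +oo[
    for all large n. *)
Definition past (n : nat) (s : R) (w : W) : \bar R :=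
  if (0 <= s + n%:R)%R then Z (s + n%:R) w - Z n%:R w else 0.

Let measurable_past n s : measurable_fun setT (past n s).
Proof.
have [sn|/negbTE sn] := boolP (0 <= s + n%:R)%R.
  rewrite (_ : past n s = Z (s + n%:R)%R \- Z n%:R).
    exact: emeasurable_funB (mZ sn) (mZ (ler0n R n)).
  by apply/funext => w; rewrite /past sn.
rewrite (_ : past n s = cst 0); first exact: measurable_cst.
by apply/funext => w; rewrite /past sn.
Qed.

Let measurable_past_path n : measurable_fun setT
  (fun w => (past n ^~ w) : paths R (\bar R)).
Proof. by apply: measurable_to_paths => s; exact: measurable_past. Qed.

Let past_law n : probability (paths R (\bar R)) R :=
  image_law (tiltZ (ler0n R n)) (measurable_past_path n).

Let past_Xi n k (t : k.-tuple R) w : (forall s, s \in t -> 0 <= s + n%:R)%R ->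
  map_tuple (past n ^~ w) t = Xi n%:R t w.
Proof.
move=> tn; apply: val_inj; rewrite /= -!map_comp; apply/eq_in_map => s /tn sn.
by rewrite /past sn.
Qed.

Let near_past (J : seq R) : exists N, forall n, (N <= n)%N ->
  forall s, s \in J -> (0 <= s + n%:R)%R.
Proof.
exists (Num.truncn (\sum_(s <- J) `|s|)%R).+1 => n Nn s sJ.
rewrite addrC -lerBlDr sub0r (le_trans (ler_norm _))// normrN.
rewrite (@le_trans _ _ (\sum_(s <- J) `|s|)%R)//.
  by rewrite (big_rem s sJ)/= lerDl sumr_ge0.
by rewrite ltW// (lt_le_trans (truncnS_gt _))// ler_nat.
Qed.

Let past_law_stable (J : seq R) : exists N, forall n (A : set (paths R (\bar R))),
  (N <= n)%N -> measurable A -> depends_on J A -> past_law n A = past_law N A.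
Proof.
have [N JN] := near_past J; exists N => n A Nn mA dA.
have [B mB ->] := depends_on_tuple mA dA.
transitivity (tiltZ (ler0n R n) [set w | B (map_tuple (past n ^~ w) (in_tuple J))]) => //.
transitivity (tiltZ (ler0n R N) [set w | B (map_tuple (past N ^~ w) (in_tuple J))]) => //.
have E m : (N <= m)%N -> [set w | B (map_tuple (past m ^~ w) (in_tuple J))] =
    [set w | B (Xi m%:R (in_tuple J) w)].
  by move=> /JN Jm; apply/funext => w /=; rewrite past_Xi.
rewrite !E//; apply: Xi_tilt => //; exact: JN.
Qed.

(** The law of Y. The laws of past n under the tilts by Z(n) are eventually
    constant on events depending on finitely many times, and the extension
    theorem applies. *)
Lemma two_sided_law : exists mu : probability (paths R (\bar R)) R,
  forall (h : R) (h0 : (0 <= h)%R) n (t : n.-tuple R) B,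
  (forall s, s \in t -> 0 <= s + h)%R -> measurable B ->
  mu [set f | B (map_tuple (fun s => finite_part (f s)) t)] =
  tiltZ h0 [set w | B (Xi h t w)].
Proof.
have [mu muE] := kolmogorov_extension past_law_stable.
exists mu => h h0 n t B th mB.
have [N1 tN1] := near_past t.
have [N2 muN2] := muE t.
pose m := maxn N1 N2.
have tm := tN1 m (leq_maxl _ _).
pose A : set (paths R (\bar R)) := [set f | B (map_tuple (fun s => finite_part (f s)) t)].
have mA : measurable A.
  have mt : measurable_fun setT (fun f : paths R (\bar R) =>
      map_tuple (fun s => finite_part (f s)) t).
    apply: measurable_map_tuple => s _.
    apply: (measurableT_comp (@measurable_finite_part R)).
    exact: measurable_evaluation.
  by have := mt measurableT _ mB; rewrite setTI.
have dA : depends_on t A.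
  move=> f g fg; rewrite /A /=; congr B; apply: val_inj => /=.
  by apply/eq_in_map => s /fg ->.
rewrite -(Xi_tilt h0 (ler0n R m))//.
rewrite (muN2 m A (leq_maxr _ _) mA dA).
transitivity (tiltZ (ler0n R m)
  [set w | B (map_tuple (fun s => finite_part (past m s w)) t)]) => //.
(* Under the tilt by Z(m), Z(m) is almost surely finite; then no increment is
   +oo and finite_part changes nothing. *)
apply: tilt_eq_off_Ny => w Zw.
change (B (map_tuple (fun s => finite_part (past m s w)) t) <-> B (Xi m%:R t w)).
suff -> : map_tuple (fun s => finite_part (past m s w)) t = Xi m%:R t w by [].
rewrite -past_Xi//; apply: val_inj; apply/eq_in_map => s /tm sm.
rewrite /finite_part /past sm ifF//.
have := Zoo w sm; have := Zoo w (ler0n R m).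
by case: (Z m%:R w) Zw => [y| |] // _ _; case: (Z _ w).
Qed.

End two_sided.

(** * Independent copies and existence of max-stable processes *)
Section iid_copies.
Context (K : choiceType) (R : realType) (mu : probability (paths K (\bar R)) R).

Let KN := (nat * K)%type.
Let big_paths := paths KN (\bar R).

Definition slice (i : nat) (f : big_paths) : paths K (\bar R) :=
  fun t => f (i, t).

Lemma measurable_slice i : measurable_fun setT (slice i).
Proof. by apply: measurable_to_paths => t; exact: measurable_evaluation. Qed.

Let measurable_slice_preimage i A : measurable A -> measurable (slice i @^-1` A).
Proof. by move=> mA; rewrite -[X in measurable X]setTI; exact: measurable_slice. Qed.

Let paste (n : nat) (fg : big_paths * paths K (\bar R)) : big_paths :=
  fun it => if it.1 == n then fg.2 it.2 else fg.1 it.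

Let measurable_paste n : measurable_fun setT (paste n).
Proof.
apply: measurable_to_paths => -[i t]; rewrite /paste/=.
case: eqP => _.
  apply: (@measurableT_comp _ _ _ _ _ _ (fun g : paths K (\bar R) => g t)).
    exact: measurable_evaluation.
  exact: measurable_snd.
apply: (@measurableT_comp _ _ _ _ _ _ (fun g : big_paths => g (i, t))).
  exact: measurable_evaluation.
exact: measurable_fst.
Qed.

Let product_prob (m : probability big_paths R) :
  probability (big_paths * paths K (\bar R))%type R := (m \x mu)%E.

(** The law of a sequence of paths of which the first n are independent with law mu
    and the following ones are 0. *)
Fixpoint copies (n : nat) : probability big_paths R :=
  if n is n'.+1 then image_law (product_prob (copies n')) (measurable_paste n')
  else dirac ((fun=> 0) : big_paths).

Let copiesS n A : copies n.+1 A = (copies n \x mu) (paste n @^-1` A).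
Proof. by []. Qed.

Let rectangle (A : nat -> set (paths K (\bar R))) N : set big_paths :=
  \bigcap_(i in [set i | (i < N)%N]) slice i @^-1` A i.

Let measurable_rectangle A N : (forall i, measurable (A i)) ->
  measurable (rectangle A N).
Proof.
move=> mA; apply: bigcap_measurableType => i _.
exact: measurable_slice_preimage (mA i).
Qed.

Let copies_rectangle N A : (forall i, measurable (A i)) ->
  copies N (rectangle A N) = \prod_(0 <= i < N) mu (A i).
Proof.
move=> mA; elim: N => [|N ih].
  rewrite big_geq// (_ : rectangle A 0 = setT) ?probability_setT//.
  by apply/seteqP; split => // f _ i.
rewrite copiesS (_ : paste N @^-1` _ = rectangle A N `*` A N).
  rewrite product_measure1E//; last exact: measurable_rectangle.
  by rewrite big_nat_recr//=; congr (_ * _); exact: ih.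
have sliceN fg : slice N (paste N fg) = fg.2.
  by apply/funext => t; rewrite /slice /paste eqxx.
have slicei fg i : (i < N)%N -> slice i (paste N fg) = slice i fg.1.
  by move=> iN; apply/funext => t; rewrite /slice /paste ltn_eqF.
apply/seteqP; split => fg /=.
  move=> Afg; split => [i /= iN|].
    by have := Afg i (ltnW iN); rewrite /= slicei.
  by have := Afg N (ltnSn N); rewrite /= sliceN.
move=> [Af Ag] i /=; rewrite ltnS leq_eqVlt => /predU1P[->|iN].
  by rewrite sliceN.
by rewrite slicei//; exact: Af.
Qed.

Let copies_stableS n (J : seq KN) (A : set big_paths) :
  (forall it, it \in J -> (it.1 < n)%N) -> measurable A -> depends_on J A ->
  copies n.+1 A = copies n A.
Proof.
move=> Jn mA dA; rewrite copiesS.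
rewrite (_ : paste n @^-1` A = A `*` setT).
  rewrite product_measure1E// -[RHS]mule1; congr (_ * _).
  exact: probability_setT.
have pE fg : {in J, paste n fg =1 fg.1}.
  by move=> it /Jn itn; rewrite /paste ltn_eqF.
apply/seteqP; split => fg /=.
  by move=> Afg; split => //; apply: dA Afg => it /pE.
by move=> [Af _]; apply: dA Af => it /pE.
Qed.

Let copies_stable N n (J : seq KN) (A : set big_paths) : (N <= n)%N ->
  (forall it, it \in J -> (it.1 < N)%N) -> measurable A -> depends_on J A ->
  copies n A = copies N A.
Proof.
move=> + JN mA dA; elim: n => [|n ih]; first by rewrite leqn0 => /eqP ->.
rewrite leq_eqVlt => /predU1P[->//|Nn]; rewrite (copies_stableS _ mA dA) ?ih//.
by move=> it /JN itN; exact: leq_trans itN Nn.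
Qed.

Let bound (J : seq KN) : exists N, forall it, it \in J -> (it.1 < N)%N.
Proof.
exists (\max_(it <- J) it.1).+1 => it itJ; rewrite ltnS.
by apply: (leq_bigmax_seq (F := fun it : KN => it.1)).
Qed.

Let finite_dim : set (set big_paths) :=
  [set A : set big_paths | measurable A /\ exists J : seq KN, depends_on J A].

Let finite_dim_generates A : measurable A -> <<s finite_dim >> A.
Proof.
move: A; apply: smallest_sub; first exact: smallest_sigma_algebra.
move=> _ [k _ [B mB <-]]; apply: sub_sigma_algebra; split.
  by rewrite setTI -[X in measurable X]setTI; exact: measurable_evaluation.
by exists [:: k] => f g fg [_ Bf]; split => //=; rewrite -fg// inE.
Qed.

Let finite_dimI : setI_closed finite_dim.
Proof.
move=> A B [mA [J dA]] [mB [J' dB]]; split; first exact: measurableI.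
exists (J ++ J') => f g fg [Af Bf]; split.
  by apply: dA Af => k kJ; apply: fg; rewrite mem_cat kJ.
by apply: dB Bf => k kJ; apply: fg; rewrite mem_cat kJ orbT.
Qed.

(** A sequence of paths indexed by K is one path indexed by nat * K, so infinitely
    many independent copies are another instance of the extension theorem: each
    further copy leaves the law of the previous ones unchanged. The rectangle
    may depend on infinitely many coordinates; the map r reduces the comparison to
    events depending on finitely many, as in the proof of that theorem. *)
Theorem iid_copies : exists Om : probability big_paths R,
  forall N (A : nat -> set (paths K (\bar R))), (forall i, measurable (A i)) ->
  Om (\bigcap_(i in [set i | (i < N)%N]) slice i @^-1` A i) =
  \prod_(0 <= i < N) mu (A i).
Proof.
have [J|Om OmE] := @kolmogorov_extension _ _ copies.
  have [N JN] := bound J; exists N => n A Nn mA dA; exact: copies_stable dA.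
exists Om => N A mA; rewrite -copies_rectangle//.
pose r (f : big_paths) : big_paths := fun it => if (it.1 < N)%N then f it else 0.
have mr : measurable_fun setT r.
  apply: measurable_to_paths => it; rewrite /r; case: (it.1 < N)%N.
    exact: measurable_evaluation.
  exact: measurable_cst.
have rE : rectangle A N = r @^-1` (rectangle A N).
  have slicer i f : (i < N)%N -> slice i (r f) = slice i f.
    by move=> iN; apply/funext => t; rewrite /slice /r iN.
  by apply/seteqP; split => f Af i /= iN; have := Af i iN; rewrite /= slicer.
rewrite -/(rectangle A N) [in LHS]rE [in RHS]rE.
have mrect := measurable_rectangle N mA.
apply: (probability_unique (m1 := image_law Om mr)
  (m2 := image_law (copies N) mr) _ finite_dimI) (finite_dim_generates mrect).
- by move=> B [].
- by split => //; exists [::].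
- move=> B [mB [J dB]].
  change (Om (r @^-1` B) = copies N (r @^-1` B)).
  have mrB : measurable (r @^-1` B) by rewrite -[X in measurable X]setTI; exact: mr.
  pose J' := [seq it <- J | (it.1 < N)%N].
  have drB : depends_on J' (r @^-1` B).
    move=> f g fg; apply: dB => it itJ; rewrite /r; case: ifPn => // itN.
    by apply: fg; rewrite mem_filter itN.
  have [M OmM] := OmE J'.
  rewrite (OmM (maxn N M) _ (leq_maxr _ _) mrB drB).
  apply: copies_stable mrB drB; first exact: leq_maxl.
  by move=> it; rewrite mem_filter => /andP[].
Qed.

End iid_copies.

(** Independence on a product space is checked on events of the factors, so events
    generated by functions of one factor must be exhibited as preimages. *)
Lemma sigma_family_comp d (V : measurableType d) d' (V' : measurableType d')
    d2 (T : measurableType d2) (K : Type) (D : set K) (X : K -> V -> T)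
    (phi : V' -> V) (A : set V') :
  sigma_family D (fun k => X k \o phi) A ->
  exists2 B, sigma_family D X B & A = phi @^-1` B.
Proof.
move=> sA.
suff [B sB <-] : preimage_set_system setT phi (sigma_family D X) A.
  by exists B => //; rewrite setTI.
move: A sA; apply: smallest_sub.
  exact/sigma_algebra_preimage/smallest_sigma_algebra.
move=> _ [k Dk [B mB <-]]; exists (X k @^-1` B); last by rewrite !setTI.
exact: sigma_family_preimage.
Qed.

(** The points live on one factor of the product space and the copies of Y on the
    other one. Since Y never takes the value +oo, finite_part does not change the
    laws of the copies and makes them processes. *)
Section max_stable_exists.
Context (R : realType).
Context d (V : measurableType d) (Q : probability V R) (pts : nat -> V -> R).
Hypothesis ppp : gumbel_poisson_process Q pts.
Context d' (W : measurableType d') (P : probability W R) (Y : R -> W -> \bar R).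
Hypothesis Y_process : process setT Y.

Let measurable_Y_path : measurable_fun setT (fun w => (Y ^~ w) : paths R (\bar R)).
Proof. by case: Y_process => mY _; apply: measurable_to_paths => s; exact: mY. Qed.

Let mu : probability (paths R (\bar R)) R := image_law P measurable_Y_path.

Let marks := paths (nat * R)%type (\bar R).

Let Om : probability marks R := projT1 (cid (iid_copies mu)).

Let Om_rectangle N (A : nat -> set (paths R (\bar R))) : (forall i, measurable (A i)) ->
  Om (\bigcap_(i in [set i | (i < N)%N]) @slice R R i @^-1` A i) =
  \prod_(0 <= i < N) mu (A i).
Proof. exact: (projT2 (cid (iid_copies mu))). Qed.

Let VO := (V * marks)%type.
Let QO : probability VO R := (Q \x Om)%E.

Let QOE (A : set V) (B : set marks) : measurable A -> measurable B ->
  QO (A `*` B) = Q A * Om B.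
Proof. by move=> mA mB; rewrite /QO /= product_measure1E. Qed.

Let pts' (i : nat) (vo : VO) : R := pts i vo.1.
Let Yc (i : nat) (s : R) (vo : VO) : \bar R := finite_part (vo.2 (i, s)).

Let mpts i : measurable_fun setT (pts i). Proof. by case: ppp. Qed.

Let QO_fst (A : set V) : measurable A -> QO (fst @^-1` A) = Q A.
Proof.
move=> mA; rewrite -[RHS]mule1 -(probability_setT Om) -QOE//.
by congr (QO _); apply/seteqP; split => vo //= -[].
Qed.

Let gumbel_pts' : gumbel_poisson_process QO pts'.
Proof.
case: ppp => _ cnt cnt_oo cnt_indep; split.
- move=> i; exact: measurableT_comp (mpts i) measurable_fst.
- move=> B mB Boo k; rewrite -cnt// -QO_fst//.
  rewrite (_ : [set _ | _] = point_count pts B @^-1` [set k%:R%:E])//.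
  rewrite -[X in measurable X]setTI; apply: measurable_point_count => //.
- move=> B mB Boo; rewrite -(cnt_oo B)// -QO_fst//.
  rewrite (_ : [set _ | _] = point_count pts B @^-1` [set +oo])//.
  rewrite -[X in measurable X]setTI; apply: measurable_point_count => //.
- move=> n B mB tB J E EJ.
  have /choice[E' EE'] : forall j, exists E'j : set V,
     g_sigma_algebra_preimage (point_count pts (B j)) E'j /\
     (j \in J -> E j = fst @^-1` E'j).
    move=> j; have [jJ|jJ] := boolP (j \in J); last first.
      exists setT; split => //; by exists setT => //; rewrite setTI preimage_setT.
    have [C mC <-] := EJ j jJ; exists (point_count pts (B j) @^-1` C); split.
      by exists C => //; rewrite setTI.
    by rewrite setTI.
  have mE' j : measurable (E' j).
    have [[C mC <-] _] := EE' j; exact: measurable_point_count.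
  transitivity (QO (fst @^-1` (\bigcap_(k in [set` J]) E' k))).
    congr (QO _); rewrite preimage_bigcap; apply: eq_bigcapr => j jJ.
    exact: (EE' j).2.
  rewrite QO_fst; last exact: fin_bigcap_measurable.
  rewrite (cnt_indep n B mB tB J E'); last by move=> j _; exact: (EE' j).1.
  rewrite big_seq [RHS]big_seq; apply: eq_bigr => j jJ.
  by rewrite (EE' j).2// QO_fst.
Qed.

Let Yc_process i : process setT (Yc i).
Proof.
split=> [s _|s vo _]; last exact: finite_part_lty.
apply: (measurableT_comp (@measurable_finite_part R)).
apply: (@measurableT_comp _ _ _ _ _ _ (fun g : marks => g (i, s))).
  exact: measurable_evaluation.
exact: measurable_snd.
Qed.

Let QO_slices N (A0 : set V) (A : nat -> set (paths R (\bar R))) :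
  measurable A0 -> (forall i, measurable (A i)) ->
  QO ((fst @^-1` A0) `&`
    \bigcap_(i in [set i | (i < N)%N]) (fun vo => slice i vo.2) @^-1` A i) =
  Q A0 * \prod_(0 <= i < N) mu (A i).
Proof.
move=> mA0 mA; rewrite -Om_rectangle// -QOE//.
apply: bigcap_measurableType => i _; rewrite -[X in measurable X]setTI.
exact: measurable_slice.
Qed.

Let QO_slice i A : measurable A -> QO ((fun vo => slice i vo.2) @^-1` A) = mu A.
Proof.
move=> mA; pose A' j := if j == i then A else setT.
have mA' j : measurable (A' j) by rewrite /A'; case: ifP.
have := @QO_slices i.+1 setT A' measurableT mA'.
have A'i : A' i = A by rewrite /A' eqxx.
rewrite probability_setT mul1e big_nat_recr//= A'i.
rewrite big_nat big1 ?mul1e => [<-|j /andP[_ ji]]; last first.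
  by rewrite /A' ltn_eqF// probability_setT.
congr (QO _); apply/seteqP; split => vo.
  move=> Avo; split => // j /= ji; rewrite /A'; case: eqP => [->//|//].
by move=> [_ /(_ i (ltnSn i))]; rewrite /A' eqxx.
Qed.

Let Yc_law i : fdd_eq setT (law QO (Yc i)) (law P Y).
Proof.
move=> n t B _ mB; rewrite /marginal /law /=.
pose A : set (paths R (\bar R)) := [set g | B (map_tuple (fun s => finite_part (g s)) t)].
have mA : measurable A.
  have mt : measurable_fun setT (fun g : paths R (\bar R) =>
      map_tuple (fun s => finite_part (g s)) t).
    apply: (@measurable_map_tuple _ (paths R (\bar R)) R (fun s g => finite_part (g s))) => s _.
    apply: (measurableT_comp (@measurable_finite_part R)).
    exact: measurable_evaluation.
  by have := mt measurableT _ mB; rewrite setTI.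
transitivity (QO ((fun vo => slice i vo.2) @^-1` A)) => //.
rewrite QO_slice//.
change (P [set w | B (map_tuple (fun s => finite_part (Y s w)) t)] =
        P [set w | B (map_tuple (Y ^~ w) t)]).
congr (P _); apply/funext => w /=; congr B; apply: val_inj => /=.
by apply: eq_map => s; rewrite finite_part_id//; case: Y_process => _; exact.
Qed.

Let Yc_sigma i E : sigma_family setT (Yc i) E ->
  exists2 A, measurable A & E = (fun vo => slice i vo.2) @^-1` A.
Proof.
move=> /(@sigma_family_comp _ (paths R (\bar R)) _ VO _ _ _ setT
  (fun s g => finite_part (g s)) (fun vo => slice i vo.2))[A sA ->].
exists A => //; apply: sigma_family_measurable sA => s _.
apply: (measurableT_comp (@measurable_finite_part R)).
exact: measurable_evaluation.
Qed.

Let marks_independent : mutually_independent QO (fun o : option nat =>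
  if o is Some i then sigma_family setT (Yc i) else sigma_family setT pts').
Proof.
move=> J E EJ.
have [A0 [mA0 A0J A0N]] : exists A0 : set V, [/\ measurable A0,
    (None \in J -> E None = fst @^-1` A0) & (None \notin J -> A0 = setT)].
  have [NJ|NJ] := boolP (None \in J); last by exists setT.
  have [A sA EA] := sigma_family_comp (EJ _ NJ); exists A; split => //.
  by apply: sigma_family_measurable sA => i _; exact: mpts.
have /choice[A AE] : forall i, exists Ai : set (paths R (\bar R)), [/\ measurable Ai,
    (Some i \in J -> E (Some i) = (fun vo => slice i vo.2) @^-1` Ai) &
    (Some i \notin J -> Ai = setT)].
  move=> i; have [iJ|iJ] := boolP (Some i \in J); last by exists setT.
  by have [Ai mAi EAi] := Yc_sigma (EJ _ iJ); exists Ai.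
have [N JN] : exists N, forall i, Some i \in J -> (i < N)%N.
  exists (\max_(o <- J) odflt 0%N o).+1 => i iJ; rewrite ltnS.
  exact: (@leq_bigmax_seq _ _ xpredT (odflt 0%N) (Some i)).
have mA i : measurable (A i) by have [] := AE i.
transitivity (Q A0 * \prod_(0 <= i < N) mu (A i)).
  rewrite -QO_slices//; congr (QO _); apply/seteqP; split => vo.
    move=> Evo; split.
      have [NJ|NJ] := boolP (None \in J); last by rewrite A0N.
      by have := Evo None NJ; rewrite A0J.
    move=> i _; have [_ AiJ AiN] := AE i.
    have [iJ|iJ] := boolP (Some i \in J); last by rewrite AiN.
    by have := Evo (Some i) iJ; rewrite AiJ.
  move=> [A0vo Avo] [i|] kJ; last by rewrite A0J.
  by have [_ AiJ _] := AE i; rewrite AiJ//; exact: Avo (JN _ kJ).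
pose G (o : option nat) := if o is Some i then mu (A i) else Q A0.
have GE o : o \in J -> QO (E o) = G o.
  case: o => [i|] oJ /=; last by rewrite A0J// QO_fst.
  by have [_ AiJ _] := AE i; rewrite AiJ// QO_slice.
transitivity (\prod_(k <- J) G k); last first.
  by rewrite big_seq [RHS]big_seq; apply: eq_bigr => k kJ; rewrite GE.
pose s : seq (option nat) := None :: map Some (iota 0 N).
have us : uniq s.
  rewrite /= map_inj_uniq ?iota_uniq ?andbT; last by move=> ? ? [].
  by apply/mapP => -[].
have sJ : perm_eq J [seq o <- s | o \in J].
  apply: uniq_perm; [exact: fset_uniq|exact: filter_uniq|].
  move=> [i|]; rewrite mem_filter; last by rewrite inE eqxx andbT.
  case: (boolP (Some i \in J)) => //= iJ.
  by rewrite inE/= map_f// mem_iota JN.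
rewrite [RHS](perm_big _ sJ) [RHS]big_filter [RHS]big_mkcond [RHS]big_cons big_map /=.
congr (_ * _).
  by case: ifPn => // /A0N ->; rewrite probability_setT.
rewrite /index_iota subn0; apply: eq_bigr => i _; case: ifPn => // iJ.
by have [_ _ ->//] := AE i; rewrite probability_setT.
Qed.

Let zetaY (s : R) (vo : VO) : \bar R :=
  ereal_sup (range (fun i => (pts' i vo)%:E + Yc i s vo)).

Theorem max_stable_exists :
  exists (dV : measure_display) (VY : measurableType dV)
    (QY : probability VY R) (zeta : R -> VY -> \bar R),
    max_stable_process setT P Y QY zeta.
Proof.
by exists _, VO, QO, zetaY, pts', Yc; split.
Qed.

End max_stable_exists.

(** * Conclusion *)
Lemma weighted_max_increments (R : realType) n (c : 'I_n -> R) (y : R)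
    (x : n.-tuple (\bar R)) :
  expeR y%:E * weighted_max c (increments y%:E x) = weighted_max c x.
Proof.
rewrite /weighted_max (big_morph (fun z => expeR y%:E * z) (op1 := maxe) (id1 := 0)).
- apply: eq_bigr => i _; rewrite tnth_map muleCA -expeRD.
  by rewrite addeC subeK.
- by move=> a b; rewrite maxe_pMr// expeR_ge0.
- by rewrite mule0.
Qed.

Lemma integral_same_law d1 (T1 : measurableType d1) d2 (T2 : measurableType d2)
    d (T : measurableType d) (R : realType) (m1 : probability T1 R)
    (m2 : probability T2 R) (X1 : T1 -> T) (X2 : T2 -> T) (f : T -> \bar R) :
  measurable_fun setT X1 -> measurable_fun setT X2 -> measurable_fun setT f ->
  (forall x, 0 <= f x) ->
  (forall B, measurable B -> m1 (X1 @^-1` B) = m2 (X2 @^-1` B)) ->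
  \int[m1]_x f (X1 x) = \int[m2]_x f (X2 x).
Proof.
move=> mX1 mX2 mf f0 m12.
transitivity (\int[pushforward m1 X1]_(y in setT) f y).
  by rewrite ge0_integral_pushforward.
transitivity (\int[pushforward m2 X2]_(y in setT) f y).
  by apply: eq_measure_integral => B mB _; exact: m12.
by rewrite ge0_integral_pushforward.
Qed.

(** Under the tilt by Z(h), the expectation of the maximum of c_j e^(Xi_j) is that of
    e^(Z(h)) max_j c_j e^(Z(t_j + h) - Z(h)) under P, restricted to Z(h) > -oo.
    The restriction loses nothing, because Z(h) > -oo almost surely. *)
Lemma two_sided_exponent (R : realType) d (W : measurableType d)
    (P : probability W R) (Z : R -> W -> \bar R)
    (mZ : forall s, (0 <= s)%R -> measurable_fun setT (Z s))
    (intZ : forall s, (0 <= s)%R -> \int[P]_w expeR (Z s w) = 1)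
    (mu : probability (paths R (\bar R)) R)
    (h : R) (h0 : (0 <= h)%R) n (t : n.-tuple R) (c : 'I_n -> R) :
  (forall w, Z h w < +oo) -> P [set w | -oo < Z h w] = 1 ->
  (forall s, s \in t -> 0 <= s + h)%R ->
  (forall B, measurable B ->
    mu [set f | B (map_tuple (fun s => finite_part (f s)) t)] =
    tiltZ mZ intZ h0 [set w | B (Xi Z h t w)]) ->
  max_exponent mu (fun s f => finite_part (f s)) t c =
  max_exponent P Z (shift_tuple h t) c.
Proof.
move=> Zoo Zfin th muE.
have mXi := measurable_Xi mZ h0 th.
have mwm := @measurable_weighted_max R n c.
rewrite /max_exponent (integral_same_law (m2 := tiltZ mZ intZ h0)
  (X2 := Xi Z h t) (f := weighted_max c) _ mXi mwm (weighted_max_ge0 c) muE); last first.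
  apply: (@measurable_map_tuple _ (paths R (\bar R)) R (fun s g => finite_part (g s))) => s _.
  apply: (measurableT_comp (@measurable_finite_part R)).
  exact: measurable_evaluation.
rewrite /tiltZ /tilt integral_tilted; first last.
- by move=> w; exact: weighted_max_ge0.
- exact: measurableT_comp mwm mXi.
- by move=> w; rewrite /= -[+oo]/(expeR +oo) lte_expeR.
have mZt : measurable_fun setT (fun w => map_tuple (Z ^~ w) (shift_tuple h t)).
  by apply: measurable_map_tuple => s /mapP[r /th rh ->]; exact: (mZ _ rh).
have mexp : measurable_fun setT (expeR \o Z h).
  exact: measurableT_comp (@measurable_expeR R) (mZ _ h0).
apply: ge0_ae_eq_integral => //.
- by apply: emeasurable_funM => //; exact: measurableT_comp mwm mXi.
- exact: measurableT_comp mwm mZt.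
- by move=> w _; rewrite mule_ge0 ?weighted_max_ge0 ?expeR_ge0.
- by move=> w _; exact: weighted_max_ge0.
have mfin : measurable [set w | -oo < Z h w].
  rewrite -[X in measurable X]setTI; apply: emeasurable_fun_o_infty => //.
  exact: (mZ _ h0).
exists (~` [set w | -oo < Z h w]); split.
- exact: measurableC.
- by have := probability_setC P mfin; rewrite Zfin subee.
- apply: subsetC => w /= Zw _; rewrite /Xi.
  by case: (Z h w) Zw (Zoo w) => [y| |]// _ _; exact: weighted_max_increments.
Qed.

Lemma exists_shift (R : realType) (J : seq R) :
  exists2 h : R, (0 <= h)%R & forall s, s \in J -> (0 <= s + h)%R.
Proof.
exists (\sum_(s <- J) `|s|)%R; first by apply: sumr_ge0.
move=> s sJ; rewrite addrC -lerBlDr sub0r (le_trans (ler_norm _))// normrN.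
by rewrite (big_rem s sJ)/= lerDl sumr_ge0.
Qed.

Theorem theorem3p1 (R : realType)
    (d : measure_display) (W : measurableType d) (P : probability W R)
    (Z : R -> W -> \bar R)
    (dQ : measure_display) (V : measurableType dQ) (Q : probability V R)
    (zetaZ : R -> V -> \bar R)
    (Z_process : process (nonneg_times R) Z)
    (Z_norm : forall t : R, (0 <= t)%R -> \int[P]_w expeR (Z t w) = 1)
    (zetaZ_assoc : max_stable_process (nonneg_times R) P Z Q zetaZ)
    (zetaZ_stationary : stationary (nonneg_times R) Q zetaZ)
    (Z_finite : forall h : R, (0 <= h)%R -> P [set w | -oo < Z h w] = 1) :
  exists (dY : measure_display) (WY : measurableType dY)
    (PY : probability WY R) (Y : R -> WY -> \bar R),
    [/\ process setT Y,
        forall (n : nat) (t : n.-tuple R) (B : set (n.-tuple (\bar R))),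
          uniq t -> measurable B ->
          let h : R := (- \big[Num.min/0]_(s <- t) s)%R in
          marginal (law PY Y) t B =
          marginal (Xi_law P Z h) (map_tuple (fun s : R => (s + h)%R) t) B,
        exists (dV : measure_display) (VY : measurableType dV)
          (QY : probability VY R) (zetaY : R -> VY -> \bar R),
          max_stable_process setT PY Y QY zetaY,
        forall (dV : measure_display) (VY : measurableType dV)
          (QY : probability VY R) (zetaY : R -> VY -> \bar R),
          max_stable_process setT PY Y QY zetaY ->
          fdd_eq (nonneg_times R) (law QY zetaY) (law Q zetaZ) &
        brown_resnick_stationary PY Y].
Proof.
have mZ s : (0 <= s)%R -> measurable_fun setT (Z s) by case: Z_process => + _; apply.
have Zoo s w : (0 <= s)%R -> Z s w < +oo by case: Z_process => _; apply.
have shiftZ h n (t : n.-tuple R) c : (0 <= h)%R -> (forall s, s \in t -> 0 <= s)%R ->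
    (forall i, (0 <= c i)%R) ->
    max_exponent P Z (shift_tuple h t) c = max_exponent P Z t c.
  apply: (stationary_max_exponent Z_process Z_norm zetaZ_assoc zetaZ_stationary).
  by move=> s k; exact: addr_ge0.
have [mu muE] := two_sided_law mZ Zoo Z_norm shiftZ.
pose Y (s : R) (f : paths R (\bar R)) := finite_part (f s).
have Y_exponent h n (t : n.-tuple R) c : (0 <= h)%R ->
    (forall s, s \in t -> 0 <= s + h)%R ->
    max_exponent mu Y t c = max_exponent P Z (shift_tuple h t) c.
  move=> h0 th; apply: (two_sided_exponent (h0 := h0)).
  - by move=> w; exact: Zoo.
  - exact: Z_finite.
  - exact: th.
  - by move=> B mB; exact: muE.
have Y_process : process setT Y.
  split=> [s _|s f _]; last exact: finite_part_lty.
  apply: (measurableT_comp (@measurable_finite_part R)).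
  exact: measurable_evaluation.
have Y_norm s : \int[mu]_f expeR (Y s f) = 1.
  have [h h0 sh] := exists_shift [:: s].
  have sh0 : (0 <= s + h)%R by apply: sh; rewrite inE.
  have one_exp d' (W' : measurableType d') (P' : probability W' R) X r :
      max_exponent P' X [tuple r] (fun=> 1%R) = \int[P']_w expeR (X r w).
    apply: eq_integral => w _; rewrite /weighted_max big_ord_recl big_ord0 mul1e.
    by rewrite (tnth_nth +oo)/= (max_idPl (expeR_ge0 _)).
  rewrite -one_exp (Y_exponent h)//.
  rewrite (_ : shift_tuple h [tuple s] = [tuple (s + h)%R]); last exact: val_inj.
  by rewrite one_exp Z_norm.
exists _, (paths R (\bar R)), mu, Y; split => //.
- move=> n t B _ mB h.
  have h0 : (0 <= h)%R by rewrite oppr_ge0 bigmin_le_id.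
  have th s : s \in t -> (0 <= s + h)%R.
    by move=> st; rewrite subr_ge0; exact: (@bigmin_inf_seq _ _ _ _ 0%R s xpredT s id st).
  rewrite /marginal /law (muE h h0 n t B th mB).
  rewrite /tiltZ /tilt tiltedE /Xi_law /tilt_law integral_mkcond.
  apply: eq_integral => w _; rewrite epatch_indic /= !indicE.
  congr (_ * (_ : bool)%:R%:E).
  have XiE : Xi Z h t w = map_tuple (fun s => Z s w - Z h w) (map_tuple (fun s => (s + h)%R) t).
    by apply: val_inj; rewrite /= -!map_comp.
  by apply/idP/idP => /set_mem Bw; apply/mem_set; move: Bw; rewrite /= XiE.
- by case: (zetaZ_assoc) => pts [Zc [ppp _ _ _]]; exact: (max_stable_exists ppp mu Y_process).
- move=> dV VY QY zetaY mY n t B tI mB; rewrite /marginal /law.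
  apply: (max_stable_marginal_eq Y_process mY Z_process zetaZ_assoc) => //.
  move=> c c0; rewrite (Y_exponent 0%R)// ?shift_tuple0// => s /tI.
  by rewrite addr0.
- move=> dV VY QY zetaY mY k _ n t B _ mB; rewrite /marginal /law.
  have [h h0 th] := exists_shift (k :: shift_tuple k t).
  have kh0 : (0 <= k + h)%R by apply: th; rewrite inE eqxx.
  have tkh s : s \in shift_tuple k t -> (0 <= s + h)%R by move=> st; apply: th; rewrite inE st orbT.
  transitivity (QY [set v | B (map_tuple (zetaY ^~ v) (shift_tuple k t))]).
    by congr (QY _); apply/funext => v /=; rewrite -map_shift_tuple.
  apply: (max_stable_marginal_eq Y_process mY Y_process mY) => // c c0.
  rewrite (Y_exponent h)// (Y_exponent (k + h)%R)// ?shift_tupleD//.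
  by move=> s st; rewrite addrA; apply: tkh; exact: map_f.
Qed.
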